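(* Let $D=\rho/\kappa$ be a skew diagram that is a sum of fat staircases, i.e. $s_D=\sum_{\nu}c_{\kappa\nu}^{\rho}s_\nu$ where the sum runs only over partitions $\nu$ that are fat staircases. Let $\lambda=(\lambda_1)$ be a single row such that $\lambda_1-1\le$ the length of the last row of $D$, and let $\lambda^t=(1^{\lambda_1})$ be its transpose. Then $$ s_{\mathcal{S}(\lambda^t,D;1)}-s_{\mathcal{S}(\lambda,D;1)}\;\ge_s\;\sum_{\nu}c_{\kappa\nu}^{\rho}\left(s_{\mathcal{S}(\lambda^t,\alpha(\nu)^{\triangleleft};1)}-s_{\mathcal{S}(\lambda,\alpha(\nu)^{\triangleleft};1)}\right)\;\ge_s\;0,$$ where the sum is over fat staircase partitions $\nu$.
   Context: Diagrams are drawn in English notation (rows top to bottom); $s_D$ is the (skew) Schur function of a skew diagram $D$, and $c_{\kappa\nu}^{\rho}$ are the Littlewood-Richardson coefficients, so $s_{\rho/\kappa}=\sum_\nu c_{\kappa\nu}^\rho s_\nu$. For symmetric functions $f,g$, write $f\ge_s g$ if $f-g$ is Schur-positive (all coefficients in the Schur basis are nonnegative). A composition $\alpha=(\alpha_1,\dots,\alpha_n)$ is a finite sequence of positive integers; $l(\alpha)=n$. Put $\delta_\alpha=(n^{\alpha_n},(n-1)^{\alpha_{n-1}},\dots,1^{\alpha_1})$, the partition with exactly $\alpha_i$ parts equal to $i$, and let $\Delta_\alpha$ be the $180^\circ$ rotation of $\delta_\alpha$. A partition $\nu$ is a fat staircase if $\nu=\delta_\alpha$ for some composition $\alpha$; then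 $\alpha(\nu)$ denotes this $\alpha$. For a skew diagram $D$, a partition $\lambda$ and $k\ge0$ with $\lambda_1-k\le$ the length of the last (bottom) row of $D$, $\mathcal{S}(\lambda,D;k)$ is the skew diagram obtained by placing the Ferrers diagram $\lambda$ immediately below $D$ so that the first row of $\lambda$ begins one row below and $k$ columns to the left of the bottom-left box of $D$. Explicitly, if the bottom-left box of $D$ is in row $r$, column $c$, then box $(i,j)$ of $\lambda$ is placed at row $r+i$, column $c-k+j-1$. For a composition $\alpha$, $\mathcal{S}(\lambda,\alpha^{\triangleleft};k)$ means $\mathcal{S}(\lambda,\Delta_\alpha;k)$ (defined when $\lambda_1-k\le l(\alpha)$). *)

(* Defs.v *)
From HB Require Import structures.
From mathcomp Require Import all_boot all_order all_algebra.
From mathcomp Require Import finmap mpoly zify.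

Set Implicit Arguments.
Unset Strict Implicit.
Unset Printing Implicit Defensive.

Import Order.TTheory GRing.Theory Num.Theory.
Local Open Scope ring_scope.
Local Open Scope fset_scope.

Definition is_intpart (s : seq nat) : bool := sorted geq s && (0%N \notin s).

Record intpart : Type := IntPart { parts :> seq nat; partsP : is_intpart parts }.
HB.instance Definition _ := [isSub for parts].
HB.instance Definition _ := [Choice of intpart by <:].

Definition intparts_of (d : nat) : seq intpart :=
  pmap insub [seq s <- [seq [seq val i | i <- val t] | t : d.-bseq 'I_d.+1]
                  | sumn s == d].

Lemma mem_intparts_of (d : nat) (nu : intpart) :
  (nu \in intparts_of d) = (sumn nu == d).
Proof.
rewrite /intparts_of mem_pmap_sub mem_filter /=; case: eqP => //= e.
have nz : 0%N \notin parts nu by case/andP: (partsP nu).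
have sz : (size nu <= d)%N.
  rewrite -e; elim: (parts nu) nz => //= x s IH; rewrite inE negb_or.
  by case/andP => x0 /IH; lia.
have le : all (fun i => i < d.+1)%N nu.
  apply/allP => x; rewrite -e ltnS; elim: (parts nu) => //= y s IH.
  by rewrite inE => /predU1P[->|/IH]; lia.
have szp : (size (pmap (insub : nat -> option 'I_d.+1) nu) <= d)%N.
  by rewrite size_pmap_sub (leq_trans (count_size _ _)).
apply/imageP; exists (Bseq szp) => //=.
rewrite pmap_filter; last by apply: insubK.
by symmetry; apply/all_filterP; apply: sub_all le => x hx; rewrite isSome_insub.
Qed.

Lemma intparts_of_uniq (d : nat) : uniq (intparts_of d).
Proof.
apply: pmap_sub_uniq; apply: filter_uniq.
rewrite map_inj_uniq ?enum_uniq // => s t e; apply: val_inj.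
exact: inj_map val_inj _ _ e.
Qed.

(* A box is (row, column); rows are numbered downwards, columns rightwards.
   Integer coordinates allow rotation and placement to the left of column 1. *)
Notation box := (int * int)%type.

Definition ferrers (s : seq nat) : {fset box} :=
  [fset b | b in [seq (i.+1%:Z, j.+1%:Z) | i <- iota 0 (size s),
                                           j <- iota 0 (nth 0%N s i)]].

Definition skew_diagram (rho kappa : seq nat) : {fset box} :=
  ferrers rho `\` ferrers kappa.

Definition rot180 (D : {fset box}) : {fset box} :=
  [fset (- b.1, - b.2) | b in D].

(* Leftmost box of the lowest row; junk value (0, 0) when D is empty. *)
Definition bottom_left (D : {fset box}) : box :=
  odflt (0, 0) (omap val [pick b : D |
    [forall b' : D, ((val b').1 < (val b).1) ||
       (((val b').1 == (val b).1) && ((val b).2 <= (val b').2))]]).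

Definition last_row_length (D : {fset box}) : nat :=
  #|` [fset b in D | b.1 == (bottom_left D).1] |.

Definition place_below (lam : seq nat) (D : {fset box}) (k : nat) : {fset box} :=
  let: (r, c) := bottom_left D in
  D `|` [fset ((r + b.1)%R, (c - k%:Z + b.2 - 1)%R) | b in ferrers lam].

Definition is_composition (alpha : seq nat) : bool := 0%N \notin alpha.

(* alpha_i is nth 0 alpha i.-1. *)
Definition delta (alpha : seq nat) : seq nat :=
  flatten [seq nseq (nth 0%N alpha i.-1) i | i <- rev (iota 1 (size alpha))].

Definition Delta (alpha : seq nat) : {fset box} := rot180 (ferrers (delta alpha)).

(* alpha(nu): how often i = 1, ..., nu_1 occurs in nu; see deltaK. *)
Definition mults (nu : seq nat) : seq nat :=
  [seq count_mem i nu | i <- iota 1 (head 0%N nu)].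

Definition fat_staircase (nu : seq nat) : bool :=
  is_composition (mults nu) && (nu == delta (mults nu)).

Lemma count_mem_delta (alpha : seq nat) (i : nat) :
  count_mem i (delta alpha) =
  if (0 < i <= size alpha)%N then nth 0%N alpha i.-1 else 0%N.
Proof.
have -> : count_mem i (delta alpha) =
    sumn [seq (j == i) * nth 0 alpha j.-1 | j <- rev (iota 1 (size alpha))]%N.
  rewrite /delta count_flatten -map_comp; congr sumn.
  by apply: eq_map => j /=; rewrite count_nseq.
rewrite map_rev sumn_rev sumnE big_map.
rewrite (eq_bigr (fun j => if j == i then nth 0 alpha j.-1 else 0)%N); last first.
  by move=> j _; case: eqP; rewrite ?mul1n ?mul0n.
case: ifP => hi.
  have ii : i \in iota 1 (size alpha) by rewrite mem_iota add1n ltnS.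
  rewrite (bigD1_seq i ii) ?iota_uniq //=.
  by rewrite eqxx big1 ?addn0 // => j /negPf ->.
rewrite big_seq big1 // => j; rewrite mem_iota => hj.
by case: eqP => // e; move: hi; rewrite -e; lia.
Qed.

Lemma deltaK (alpha : seq nat) :
  is_composition alpha -> mults (delta alpha) = alpha.
Proof.
move=> ca; have hd : head 0%N (delta alpha) = size alpha.
  case: (lastP alpha) ca => [|s x] //; rewrite /is_composition mem_rcons inE.
  rewrite negb_or => /andP[x0 _]; rewrite /delta size_rcons -(addn1 (size s)) iotaD rev_cat.
  rewrite /= add1n /= nth_rcons ltnn eqxx addn1.
  by case: x x0.
apply: (@eq_from_nth _ 0%N); rewrite /mults hd size_map size_iota // => i hi.
by rewrite (nth_map 0%N) ?size_iota // nth_iota // count_mem_delta add1n /= hi.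
Qed.

Lemma fat_staircaseP (nu : seq nat) :
  reflect (exists2 alpha, is_composition alpha & nu = delta alpha)
          (fat_staircase nu).
Proof.
apply: (iffP andP) => [[ca /eqP e]|[a ca ->]]; first by exists (mults nu).
by rewrite deltaK.
Qed.

Section Tableaux.
Variables (D : {fset box}) (n : nat).
Implicit Type T : {ffun D -> 'I_n}.

Definition ssyt T : bool :=
  [forall b : D, forall b' : D,
     (((val b).1 == (val b').1) && ((val b).2 < (val b').2) ==> (T b <= T b')%N)
  && (((val b).2 == (val b').2) && ((val b).1 < (val b').1) ==> (T b < T b')%N)].

(* b' is read no later than b: rows top to bottom, each from right to left. *)
Definition read_le (b' b : D) : bool :=
  ((val b').1 < (val b).1) ||
  (((val b').1 == (val b).1) && ((val b).2 <= (val b').2)).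

Definition lattice T : bool :=
  [forall b : D, forall i : 'I_n, forall j : 'I_n, (j == i.+1 :> nat) ==>
     (#|[set b' | read_le b' b & T b' == j]|
       <= #|[set b' | read_le b' b & T b' == i]|)%N].

Definition has_content T (m : seq nat) : bool :=
  [forall i : 'I_n, #|[set b | T b == i]| == nth 0%N m i].

End Tableaux.

(* Littlewood-Richardson coefficient, for kappa contained in rho. *)
Definition lrcoef (kappa nu rho : seq nat) : nat :=
  #|[set T : {ffun skew_diagram rho kappa -> 'I_(size nu)} |
      [&& ssyt T, has_content T nu & lattice T]]|.

(* A symmetric function is given by its truncations f(x_1, ..., x_n) for all n;
   the type itself does not impose symmetry or compatibility in n. *)
Definition symfct : Type := forall n : nat, {mpoly int[n]}.

Definition schur (D : {fset box}) : symfct := fun n =>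
  \sum_(T : {ffun D -> 'I_n} | ssyt T) \prod_(b : D) 'X_(T b).

Definition schur_ge (f g : symfct) : Prop :=
  exists2 a : {fsfun intpart -> int with 0},
    (forall nu : intpart, 0 <= a nu) &
    (forall n : nat,
       f n - g n = \sum_(nu <- finsupp a) a nu *: schur (ferrers nu) n).

(* c_{kappa nu}^rho vanishes unless |nu| = |rho| - |kappa|, the number of boxes
   of rho/kappa, so the sums over nu below run over partitions of that size. *)
Definition fat_staircases_of (d : nat) : seq intpart :=
  [seq nu <- intparts_of d | fat_staircase (parts nu)].

Definition sum_of_fat_staircases (rho kappa : intpart) : Prop :=
  forall n : nat,
    schur (skew_diagram rho kappa) n =
    \sum_(nu <- fat_staircases_of #|` skew_diagram rho kappa|)
       schur (ferrers nu) n *+ lrcoef kappa nu rho.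

(* Main.v *)
(* All Schur expansions are obtained from the Littlewood-Richardson rule, proved as
   by Stembridge: multiply by the alternant of rho and cancel the non-lattice
   tableaux by Bender-Knuth involutions acting left of a column.  It applies to
   every diagram that is convex for the componentwise order of boxes.

   Let T be a Littlewood-Richardson filling of S((m), D; 1) with last row x.  Its
   restriction to D is a Littlewood-Richardson filling, of content nu say, and the
   content mu of T is nu plus a horizontal strip.  If D is a sum of fat staircases,
   consecutive parts of nu differ by at most 1, hence the letters of x are distinct
   and mu / nu is also a vertical strip; in particular T is determined by its
   restriction and mu.  Conversely, for each mu such that mu / nu is both a
   horizontal and a vertical strip of size m, the unique filling of the rotated
   diagram Delta with content nu extends to a filling of S((m), Delta; 1) with
   content mu.  This gives s_S((m),D;1) <= sum_nu c_nu s_S((m),Delta_nu;1).  As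
   S((1^m), D; 1) is a disconnected union, its Schur function is e_m s_D, which is
   linear in s_D; the first inequality follows.  The second one holds because
   strictly increasing rows x may be rewritten as columns. *)
Require Import Defs.
From mathcomp Require Import all_boot all_order all_algebra.
From mathcomp Require Import fingroup perm.
From mathcomp Require Import finmap mpoly zify.
From mathcomp Require Import boolp.
Import Order.TTheory GRing.Theory Num.Theory.
Local Open Scope fset_scope.
Local Open Scope ring_scope.

Set Implicit Arguments.
Unset Strict Implicit.
Unset Printing Implicit Defensive.

(** * Alternating polynomials *)

(** The difficulty is that a row, unlike a column, is attached to D, so the Schur function of S((m),
    D; 1) is not determined by s_D; it can only be bounded. The value k = 1 is what makes the bound
    work. Letters start at 0 here. Just the first box of the added row juts out to the left, and
    each later box has a box of D above it, which forbids the letter 0 there; a repeated positive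
    letter is forbidden by the small drops of nu. The bound m - 1 <= length of the last row keeps
    the diagram convex, so that the expansion applies to it.

    Reading by columns fits the cancellation: an involution acting strictly left of a column changes
    none of the letters by which the failure of the lattice condition was detected. The price is a
    second family of coefficients, [lr_col]. It is tied to the coefficients of the hypothesis by
    linear independence of Schur polynomials in d variables, where d is the number of boxes, so that
    every partition of d has enough variables. *)

Lemma tperm_adjacent_ind (n : nat) (P : 'S_n -> Prop) :
  P 1%g -> (forall s t, P s -> P t -> P (s * t)%g) ->
  (forall i j : 'I_n, j = i.+1 :> nat -> P (tperm i j)) ->
  forall s, P s.
Proof.
move=> P1 PM Padj.
have Pt d : forall i j : 'I_n, j = (i + d)%N :> nat -> P (tperm i j).
  elim: d => [|d IH] i j e.
    by rewrite (_ : j = i) ?tperm1 //; apply: val_inj; rewrite /= e addn0.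
  have hk : (i + d < n)%N by have := ltn_ord j; lia.
  case: d IH e hk => [|d] IH e hk; first by apply: Padj; lia.
  pose k := Ordinal hk.
  have -> : tperm i j = (tperm i k ^ tperm k j)%g.
    rewrite tpermJ tpermL tpermD //; apply/eqP => /(congr1 (@nat_of_ord _)) /=; lia.
  have Pkj : P (tperm k j) by apply: Padj => /=; lia.
  by rewrite conjgE tpermV; apply: (PM) => //; apply: (PM) => //; apply: IH.
move=> s; case: (prod_tpermP s) => ts -> _.
elim: ts => [|[a b] ts IH]; first by rewrite big_nil.
rewrite big_cons; apply: PM => //=.
have [ab|/ltnW ba] := leqP a b; first by apply: (Pt (b - a)%N); lia.
by rewrite tpermC; apply: (Pt (a - b)%N); lia.
Qed.

Lemma symmetric_adjacent (n : nat) (p : {mpoly int[n]}) :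
  (forall i j : 'I_n, j = i.+1 :> nat -> msym (tperm i j) p = p) ->
  forall s, msym s p = p.
Proof.
move=> h; apply: tperm_adjacent_ind => //; first exact: msym1m.
by move=> s t hs ht; rewrite msymMm hs.
Qed.

Definition alt (n : nat) (p : {mpoly int[n]}) : {mpoly int[n]} :=
  \sum_(s : 'S_n) (-1) ^+ s *: msym s p.

Lemma alt_sum (n : nat) (I : Type) (r : seq I) (P : pred I)
    (F : I -> {mpoly int[n]}) :
  alt (\sum_(i <- r | P i) F i) = \sum_(i <- r | P i) alt (F i).
Proof.
rewrite /alt exchange_big; apply: eq_bigr => s _ /=.
by rewrite (raddf_sum (msym s)) scaler_sumr.
Qed.

Lemma alt_msym (n : nat) (t : 'S_n) (p : {mpoly int[n]}) :
  alt (msym t p) = (-1) ^+ t *: alt p.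
Proof.
rewrite /alt scaler_sumr [RHS](reindex_inj (mulgI t)) /=; apply: eq_bigr => s _.
by rewrite scalerA msymMm odd_permM signr_addb mulrA -signr_addb addbb mul1r.
Qed.

Lemma altM (n : nat) (p q : {mpoly int[n]}) :
  (forall s, msym s q = q) -> alt (p * q) = alt p * q.
Proof.
move=> hq; rewrite /alt mulr_suml; apply: eq_bigr => s _.
by rewrite msymM hq scalerAl.
Qed.

Definition rho_monom (n : nat) : 'X_{1..n} := [multinom (n - i.+1)%N | i < n].

(** Such an s is increasing, hence s i >= i for all i; as both sides have the same sum over i,
    equality holds everywhere. *)
Lemma decreasing_perm1 (n : nat) (m m' : 'X_{1..n}) (s : 'S_n) :
  (forall i j : 'I_n, (i < j)%N -> (m j < m i)%N) ->
  (forall i j : 'I_n, (i < j)%N -> (m' j < m' i)%N) ->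
  [multinom m (s i) | i < n] = m' -> s = 1%g.
Proof.
move=> hm hm' e.
have e' i : m' i = m (s i) by rewrite -e mnmE.
have hs (i j : 'I_n) : (i < j)%N -> (s i < s j)%N.
  move=> ij; rewrite ltnNge; apply/negP => ji.
  have := hm' _ _ ij; rewrite !e'; move: ji; rewrite leq_eqVlt => /orP[/eqP/val_inj ->|/hm]; lia.
have ge (i : 'I_n) : (i <= s i)%N.
  case: i => k; elim: k => //= k IH hk.
  have hk' := ltnW hk.
  apply: leq_ltn_trans (IH hk') _; exact: hs.
apply/permP => i; rewrite perm1; apply: val_inj => /=.
have: (\sum_(i : 'I_n) (s i - i) = 0)%N.
  rewrite sumnB // [X in (X - _)%N](_ : _ = \sum_(i < n) i)%N ?subnn //.
  by rewrite [RHS](reindex_inj (@perm_inj _ s)).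
by move/eqP; rewrite sum_nat_eq0 => /forallP /(_ i) /=; have := ge i; lia.
Qed.

Lemma mcoeff_alt (n : nat) (m m' : 'X_{1..n}) :
  (forall i j : 'I_n, (i < j)%N -> (m j < m i)%N) ->
  (forall i j : 'I_n, (i < j)%N -> (m' j < m' i)%N) ->
  (alt 'X_[m])@_m' = (m == m')%:R.
Proof.
move=> hm hm'; rewrite /alt raddf_sum /= (bigD1 1%g) //= big1 ?addr0.
  by rewrite odd_perm1 expr0 scale1r msym1m mcoeffX.
move=> s s1; rewrite mcoeffZ msymX mcoeffX; case: eqP => [e|_]; last by rewrite mulr0.
by case/eqP: s1; apply: invg_inj; rewrite invg1; apply: decreasing_perm1 e.
Qed.

Lemma rho_decr (n : nat) (w : 'X_{1..n}) :
  (forall i j : 'I_n, (i < j)%N -> (w j <= w i)%N) ->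
  forall i j : 'I_n, (i < j)%N -> ((w + rho_monom n)%MM j < (w + rho_monom n)%MM i)%N.
Proof.
move=> h i j ij; rewrite !mnmDE !mnmE; have := h _ _ ij.
have := ltn_ord j; lia.
Qed.

Definition alt_rho (n : nat) : {mpoly int[n]} := alt 'X_[rho_monom n].

(** Allows the alternant of rho to be cancelled, integer polynomials being an integral domain. *)
Lemma alt_rho_neq0 (n : nat) : alt_rho n != 0.
Proof.
have h (i j : 'I_n) : (i < j)%N -> (rho_monom n j < rho_monom n i)%N.
  by move=> ij; rewrite !mnmE; have := ltn_ord j; lia.
apply/eqP => e; have := mcoeff_alt h h; rewrite -/(alt_rho n) e mcoeff0 eqxx.
by move/eqP; rewrite eq_sym oner_eq0.
Qed.
(** * Bender-Knuth involutions *)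

Lemma rev_index_lt (s i : nat) : (i < s)%N -> (s - i.+1 < s)%N.
Proof. lia. Qed.

Lemma rev_indexK (s i : nat) : (i < s)%N -> (s - (s - i.+1).+1)%N = i.
Proof. lia. Qed.

Section Flip.
Variables (X : finType) (row col : X -> int) (A : {set X}).

Definition partner (x : X) : option X :=
  [pick x' in A | (x' != x) && (col x' == col x)].

Definition free_row (r : int) : seq X :=
  sort (fun x y => col x <= col y)
       (enum [set x in A | (partner x == None) && (row x == r)]).

(* An involution on A: the two elements of a column are exchanged, and the
   elements that are alone in their column are reversed within each row. *)
Definition flip (x : X) : X :=
  if partner x is Some x' then x'
  else nth x (rev (free_row (row x))) (index x (free_row (row x))).

Hypothesis rc_inj : forall x y, row x = row y -> col x = col y -> x = y.
Hypothesis col_le2 : forall x y z, x \in A -> y \in A -> z \in A ->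
  col x = col y -> col y = col z -> x != y -> x != z -> y = z.

Lemma partnerP x y : partner x = Some y -> [/\ y \in A, y != x & col y = col x].
Proof. by rewrite /partner; case: pickP => // z /and3P[zA zx /eqP e] [<-]. Qed.

Lemma partnerN x y :
  partner x = None -> y \in A -> col y = col x -> y = x.
Proof.
rewrite /partner; case: pickP => // h _ yA e.
by have := h y; rewrite /= yA e eqxx andbT /= => /negbFE/eqP.
Qed.

Lemma partnerK x y : x \in A -> partner x = Some y -> partner y = Some x.
Proof.
move=> xA /partnerP[yA yx e]; case e' : (partner y) => [z|].
  have [zA zy ez] := partnerP e'.
  congr Some; apply: (@col_le2 y) => //; first by congruence.
  by rewrite eq_sym.
by have := partnerN e' xA (esym e) => exy; rewrite exy eqxx in yx.
Qed.

Lemma mem_free_row r x :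
  (x \in free_row r) = [&& x \in A, partner x == None & row x == r].
Proof. by rewrite mem_sort mem_enum inE. Qed.

Lemma free_row_uniq r : uniq (free_row r).
Proof. by rewrite sort_uniq enum_uniq. Qed.

Lemma free_row_sorted r (x0 : X) (i j : nat) :
  (i < j)%N -> (j < size (free_row r))%N ->
  col (nth x0 (free_row r) i) < col (nth x0 (free_row r) j).
Proof.
move=> ij js; have isz := ltn_trans ij js.
have := sorted_leq_nth (leT := fun x y => col x <= col y) _ _ x0
  (sort_sorted _ (enum [set x in A | (partner x == None) && (row x == r)])).
move=> /(_ (fun y x z => @le_trans _ _ _ _ _) (fun x => lexx _)
          (fun x y => le_total _ _) i j isz js (ltnW ij)).
rewrite -/(free_row r) le_eqVlt => /orP[/eqP e|//].
have := mem_nth x0 isz; have := mem_nth x0 js; rewrite !mem_free_row.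
move=> /and3P[_ _ /eqP rj] /and3P[_ _ /eqP ri].
have /eqP := rc_inj (etrans ri (esym rj)) e.
by rewrite nth_uniq ?free_row_uniq // => /eqP eij; rewrite eij ltnn in ij.
Qed.

Lemma free_row_index r x y : x \in free_row r -> y \in free_row r ->
  col x < col y -> (index x (free_row r) < index y (free_row r))%N.
Proof.
move=> xs ys xy; rewrite ltnNge leq_eqVlt; apply/negP => /orP[/eqP e|lt].
  by move: xy; rewrite -(nth_index x xs) -(nth_index x ys) e ltxx.
have := free_row_sorted (r := r) x lt; rewrite index_mem => /(_ xs).
by rewrite !nth_index // => /lt_trans /(_ xy); rewrite ltxx.
Qed.

Lemma flip_free x : x \in A -> partner x = None ->
  [/\ flip x \in A, partner (flip x) = None, row (flip x) = row x & flip (flip x) = x].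
Proof.
move=> xA xN; have xs : x \in free_row (row x) by rewrite mem_free_row xA xN !eqxx.
have is_ : (index x (free_row (row x)) < size (free_row (row x)))%N by rewrite index_mem.
have e : flip x = nth x (free_row (row x)) (size (free_row (row x)) - (index x (free_row (row x))).+1).
  by rewrite /flip xN nth_rev.
have fs : flip x \in free_row (row x) by rewrite e mem_nth // rev_index_lt.
move: (fs); rewrite mem_free_row => /and3P[fA /eqP fN /eqP fr]; split=> //.
rewrite {1}/flip fN fr e index_uniq ?free_row_uniq ?rev_index_lt //.
by rewrite nth_rev ?rev_index_lt // rev_indexK // (set_nth_default x) ?nth_index.
Qed.

Lemma flip_decr x y : x \in A -> y \in A -> partner x = None -> partner y = None ->
  row x = row y -> col x < col y -> col (flip y) < col (flip x).
Proof.
move=> xA yA xN yN exy xy.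
have xs : x \in free_row (row y) by rewrite mem_free_row xA xN exy !eqxx.
have ys : y \in free_row (row y) by rewrite mem_free_row yA yN !eqxx.
have := free_row_index xs ys xy; move: (xs) (ys); rewrite -!index_mem => ix iy lt.
rewrite /flip xN yN exy !nth_rev // [nth y _ _](set_nth_default x); last first.
  exact: rev_index_lt.
apply: free_row_sorted; last exact: rev_index_lt.
by apply: ltn_sub2l; first exact: leq_ltn_trans lt iy.
Qed.

Lemma flipK x : x \in A -> flip x \in A /\ flip (flip x) = x.
Proof.
move=> xA; case e : (partner x) => [y|]; last by case: (flip_free xA e).
have ey := partnerK xA e; have [yA _ _] := partnerP e.
have fx : flip x = y by rewrite /flip e.
by rewrite fx; split; rewrite // /flip ey.
Qed.

End Flip.

Lemma rc_inj (D : {fset box}) (x y : D) :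
  (val x).1 = (val y).1 -> (val x).2 = (val y).2 -> x = y.
Proof. by move=> e1 e2; apply: val_inj; move: e1 e2; case: (val x) (val y) => [? ?] [? ?] /= -> ->. Qed.

(** A form of skewness that passes to rotated diagrams and, under the length bound for the row, to
    both placements below D, so that no pair of partitions has to be exhibited for these. *)
Definition convex (D : {fset box}) : Prop := forall b b' x : box,
  b \in D -> b' \in D -> b.1 <= x.1 <= b'.1 -> b.2 <= x.2 <= b'.2 -> x \in D.

Lemma ssytP (D : {fset box}) (n : nat) (T : {ffun D -> 'I_n}) :
  reflect ((forall b b' : D, (val b).1 = (val b').1 -> (val b).2 < (val b').2 -> (T b <= T b')%N)
           /\ (forall b b' : D, (val b).2 = (val b').2 -> (val b).1 < (val b').1 -> (T b < T b')%N))
          (ssyt T).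
Proof.
apply: (iffP idP) => [h|[h1 h2]].
  split=> b b' e lt; have /andP[/implyP h1 /implyP h2] := forallP (forallP h b) b'.
    by apply: h1; rewrite e eqxx.
  by apply: h2; rewrite e eqxx.
apply/forallP => b; apply/forallP => b'; apply/andP; split; apply/implyP => /andP[/eqP e lt].
  exact: h1.
exact: h2.
Qed.

Definition weight (D : {fset box}) (n : nat) (P : pred D) (T : {ffun D -> 'I_n}) : 'X_{1..n} :=
  (\sum_(b : D | P b) U_(T b))%MM.

Lemma weightE (D : {fset box}) (n : nat) (P : pred D) (T : {ffun D -> 'I_n}) (k : 'I_n) :
  weight P T k = (\sum_(b : D | P b) (T b == k))%N.
Proof. by rewrite /weight mnm_sumE; apply: eq_bigr => b _; rewrite mnm1E. Qed.

Section BenderKnuth.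
Variables (D : {fset box}) (n : nat) (i i' : 'I_n) (c : int).
Hypothesis (Dconv : convex D) (ii' : i' = i.+1 :> nat).
Implicit Types (T : {ffun D -> 'I_n}) (x y : D).

Let row x := (val x).1.
Let col x := (val x).2.

Definition bkset T : {set D} := [set x | (col x < c) && ((T x == i) || (T x == i'))].

(** The usual rule turns p free letters i followed by q free letters i' in a row into q letters i
    followed by p letters i'. Flipping positions and exchanging letters has the same effect and
    makes the involution visible. In a column containing both letters the two exchanges undo each
    other. *)
Definition bender_knuth T : {ffun D -> 'I_n} :=
  [ffun x => if x \in bkset T then tperm i i' (T (flip row col (bkset T) x)) else T x].

Lemma ssyt_col T x y : ssyt T -> col x = col y -> T x = T y -> x = y.
Proof.
case/ssytP => _ h e1 e2; case: (ltgtP (row x) (row y)) => lt.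
- by have := h _ _ e1 lt; rewrite e2 ltnn.
- by have := h _ _ (esym e1) lt; rewrite e2 ltnn.
exact: rc_inj.
Qed.

Lemma bkset_le2 T : ssyt T -> forall x y z, x \in bkset T -> y \in bkset T ->
  z \in bkset T -> col x = col y -> col y = col z -> x != y -> x != z -> y = z.
Proof.
move=> hT x y z; rewrite !inE => /andP[_ hx] /andP[_ hy] /andP[_ hz] exy eyz xy xz.
have nxy : T x != T y by apply: contra_neq xy; apply: (ssyt_col hT).
have nxz : T x != T z by apply: contra_neq xz; apply: (ssyt_col hT); congruence.
apply: (ssyt_col hT) => //.
move: hx hy hz nxy nxz => /orP[] /eqP-> /orP[] /eqP-> /orP[] /eqP->; by rewrite ?eqxx.
Qed.

Lemma bk_in T x : ssyt T -> x \in bkset T -> bender_knuth T x = i \/ bender_knuth T x = i'.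
Proof.
move=> hT xA; rewrite ffunE xA.
have [fA _] := flipK row (bkset_le2 hT) xA; move: fA; rewrite inE.
by case/andP => _ /orP[]/eqP ->; rewrite (tpermL, tpermR); [right|left].
Qed.

Lemma bk_out T x : x \notin bkset T -> bender_knuth T x = T x.
Proof. by rewrite ffunE => /negPf ->. Qed.

Lemma bkset_bk T : ssyt T -> bkset (bender_knuth T) = bkset T.
Proof.
move=> hT; apply/setP => x; have [xA|xA] := boolP (x \in bkset T).
  move: (xA); rewrite !inE => /andP[-> _] /=.
  by case: (bk_in hT xA) => ->; rewrite eqxx ?orbT.
by rewrite inE bk_out //; move: xA; rewrite inE => /negPf.
Qed.

Lemma bkK T : ssyt T -> bender_knuth (bender_knuth T) = T.
Proof.
move=> hT; apply/ffunP => x; rewrite ffunE bkset_bk //; case: ifP => xA; last by rewrite ffunE xA.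
have [fA fK] := flipK row (bkset_le2 hT) xA.
by rewrite ffunE fA fK tpermK.
Qed.

Lemma bk_right T x : c <= col x -> bender_knuth T x = T x.
Proof. by move=> h; rewrite bk_out // inE ltNge h. Qed.

Lemma bk_partner T x : ssyt T -> x \in bkset T ->
  partner col (bkset T) x != None -> bender_knuth T x = T x.
Proof.
move=> hT xA; case e: (partner _ _ x) => [y|] // _; rewrite ffunE xA /flip e.
have [yA yx ec] := partnerP e.
have nT : T y != T x by apply: contra_neq yx; apply: (ssyt_col hT).
move: xA yA nT; rewrite !inE => /andP[_ /orP[]/eqP ->] /andP[_ /orP[]/eqP ->]; rewrite ?eqxx //.
  by rewrite tpermR.
by rewrite tpermL.
Qed.

Lemma swap_le (a b : 'I_n) : (b <= a)%N -> (a == i) || (a == i') ->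
  (b == i) || (b == i') -> (tperm i i' a <= tperm i i' b)%N.
Proof.
by move=> ba /orP[]/eqP ea /orP[]/eqP eb; subst a b; rewrite ?tpermL ?tpermR //; move: ba; rewrite ii' // ltnn.
Qed.

Lemma bk_free_mono T x y : ssyt T -> x \in bkset T -> y \in bkset T ->
  partner col (bkset T) x = None -> partner col (bkset T) y = None ->
  row x = row y -> col x < col y -> (bender_knuth T x <= bender_knuth T y)%N.
Proof.
move=> hT xA yA xN yN e lt; rewrite !ffunE xA yA.
have dec := flip_decr (row := row) (@rc_inj D) xA yA xN yN e lt.
have [fxA _ fxr _] := flip_free row xA xN.
have [fyA _ fyr _] := flip_free row yA yN.
have/ssytP[/(_ _ _ _ dec) h _] := hT.
have {}h := h (etrans fyr (etrans (esym e) (esym fxr))).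
rewrite inE in fxA; rewrite inE in fyA; case/andP: fxA => _ fxA; case/andP: fyA => _ fyA.
exact: swap_le.
Qed.

Lemma sub_convex x y (b : box) : (val x).1 <= b.1 <= (val y).1 -> (val x).2 <= b.2 <= (val y).2 ->
  exists z : D, val z = b.
Proof.
move=> h1 h2; have bD : b \in D by apply: (Dconv (valP x) (valP y)).
by exists [` bD].
Qed.

(* The letter i' with an i above it cannot have a free i' on its right, and a free i
   cannot have on its right an i with an i' below it. *)
Lemma bk_mono T x y : ssyt T -> x \in bkset T -> y \in bkset T ->
  row x = row y -> col x < col y -> (bender_knuth T x <= bender_knuth T y)%N.
Proof.
move=> hT xA yA e lt; have/ssytP[hrow hcol] := hT.
have le := hrow _ _ e lt.
case ex: (partner col (bkset T) x) => [x1|]; case ey: (partner col (bkset T) y) => [y1|].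
- by rewrite !bk_partner ?ex ?ey.
- rewrite (bk_partner hT xA) ?ex //.
  case: (bk_in hT yA) => ->; last first.
    by move: xA; rewrite !inE => /andP[_ /orP[]/eqP ->]; lia.
  have [x1A x1x ec] := partnerP ex.
  have nT : T x1 != T x by apply: contra_neq x1x; apply: (ssyt_col hT).
  case Tx : (T x == i); first by rewrite (eqP Tx).
  have {}Tx : T x = i' by move: xA; rewrite !inE Tx => /andP[_ /eqP].
  have Tx1 : T x1 = i.
    by move: x1A; rewrite !inE => /andP[_ /orP[]/eqP //]; rewrite Tx in nT => e1; rewrite e1 eqxx in nT.
  have Ty : T y = i' by move: yA le; rewrite !inE Tx => /andP[_ /orP[]/eqP -> //]; lia.
  have r1 : row x1 < row x.
    case: (ltgtP (row x1) (row x)) => // [gt|er].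
      by have := hcol _ _ (esym ec) gt; rewrite Tx Tx1; lia.
    by rewrite (rc_inj er ec) eqxx in x1x.
  have [||z ez] := @sub_convex x1 y (row x1, col y).
  - by apply/andP; split; [apply: lexx | rewrite -/(row y) -e; apply: ltW].
  - by apply/andP; split; [rewrite -/(col x1) ec; apply: ltW | apply: lexx].
  have zc : col z = col y by rewrite /col ez.
  have zr : row z = row x1 by rewrite /row ez.
  have lt1 : (T z < T y)%N by apply: hcol; rewrite // -/(row z) -/(row y) zr -e.
  have le1 : (T x1 <= T z)%N by apply: hrow; rewrite // -/(col z) -/(col x1) zc ec.
  have zA : z \in bkset T.
    rewrite inE; move: yA; rewrite inE zc => /andP[-> _] /=; apply/orP; left.
    by apply/eqP/val_inj => /=; move: lt1 le1; rewrite Ty Tx1; lia.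
  by have zy := partnerN ey zA zc; rewrite zy ltnn in lt1.
- rewrite (bk_partner hT yA) ?ey //.
  case: (bk_in hT xA) => ->.
    by move: yA; rewrite !inE => /andP[_ /orP[]/eqP ->]; lia.
  have [y1A y1y ec] := partnerP ey.
  have nT : T y1 != T y by apply: contra_neq y1y; apply: (ssyt_col hT).
  case Ty : (T y == i'); first by rewrite (eqP Ty).
  have {}Ty : T y = i by move: yA; rewrite !inE Ty orbF => /andP[_ /eqP].
  have Ty1 : T y1 = i'.
    by move: y1A; rewrite !inE => /andP[_ /orP[]/eqP //]; rewrite Ty in nT => e1; rewrite e1 eqxx in nT.
  have Tx : T x = i by move: xA le; rewrite !inE Ty => /andP[_ /orP[]/eqP -> //]; lia.
  have r1 : row y < row y1.
    case: (ltgtP (row y) (row y1)) => // [gt|er].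
      by have := hcol _ _ ec gt; rewrite Ty Ty1; lia.
    by rewrite (rc_inj (esym er) ec) eqxx in y1y.
  have [||z ez] := @sub_convex x y1 (row y1, col x).
  - by apply/andP; split; [rewrite -/(row x) e; apply: ltW | apply: lexx].
  - by apply/andP; split; [apply: lexx | rewrite -/(col y1) ec; apply: ltW].
  have zc : col z = col x by rewrite /col ez.
  have zr : row z = row y1 by rewrite /row ez.
  have lt1 : (T x < T z)%N by apply: hcol; rewrite // -/(row z) -/(row x) zr e.
  have le1 : (T z <= T y1)%N by apply: hrow; rewrite // -/(col z) -/(col y1) zc ec.
  have zA : z \in bkset T.
    rewrite inE; move: xA; rewrite inE zc => /andP[-> _] /=; apply/orP; right.
    by apply/eqP/val_inj => /=; move: lt1 le1; rewrite Tx Ty1; lia.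
  by have zy := partnerN ex zA zc; rewrite zy ltnn in lt1.
- exact: bk_free_mono.
Qed.

(** The condition on column c guards the border. Turning an i left of c into i' does harm only if
    its row has an i in some column >= c, and by convexity that row would then have an i in column c
    itself. *)
Lemma bk_ssyt T : ssyt T -> (forall x, col x = c -> T x != i) -> ssyt (bender_knuth T).
Proof.
move=> hT hc; have/ssytP[hrow hcol] := hT; apply/ssytP; split=> x y e lt.
  have le := hrow _ _ e lt.
  have [xA|xA] := boolP (x \in bkset T); have [yA|yA] := boolP (y \in bkset T).
  - exact: bk_mono.
  - rewrite (bk_out yA); have := bk_in hT xA.
    move: xA yA; rewrite !inE negb_and => /andP[xc Tx]; case/orP => [yc|yT]; last first.
      have : T y != i :> nat by apply: contraNneq yT => /val_inj ->; rewrite eqxx.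
      have : T y != i' :> nat by apply: contraNneq yT => /val_inj ->; rewrite eqxx orbT.
      by case/orP: Tx le => /eqP-> ? ? ? [] ->; lia.
    suff : T y != i :> nat by case/orP: Tx le => /eqP-> ? ? [] ->; lia.
    apply/eqP => /val_inj Ty; rewrite -leNgt in yc.
    case: (ltgtP (col y) c) => [lt1|gt1|eqc]; first by rewrite ltNge yc in lt1.
      have [||z ez] := @sub_convex x y (row x, c).
      - by apply/andP; split; [apply: lexx | rewrite /row e; apply: lexx].
      - by apply/andP; split; apply: ltW.
      have zc : col z = c by rewrite /col ez.
      have zr : row z = row x by rewrite /row ez.
      have l1 : (T x <= T z)%N by apply: hrow; rewrite // -/(col z) zc.
      have l2 : (T z <= T y)%N.
        apply: hrow; last by rewrite -/(col z) zc.
        by rewrite -/(row z) zr.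
      have/eqP := hc _ zc; apply; apply: val_inj => /=.
      by move: Tx l1 l2; rewrite Ty => /orP[]/eqP ->; lia.
    by have := hc _ eqc; rewrite Ty eqxx.
  - rewrite (bk_out xA); have := bk_in hT yA.
    move: xA yA; rewrite !inE negb_and => xA /andP[yc Ty].
    have xc : col x < c by apply: lt_trans lt yc.
    move: xA; rewrite xc /= negb_or => /andP[n1 n2].
    have : T x != i :> nat by apply: contraNneq n1 => /val_inj ->.
    have : T x != i' :> nat by apply: contraNneq n2 => /val_inj ->.
    by case/orP: Ty le => /eqP-> ? ? ? [] ->; lia.
  - by rewrite !bk_out.
have ltT := hcol _ _ e lt.
have side z : col z = col x -> z \notin bkset T -> x \in bkset T \/ y \in bkset T ->
    T z != i :> nat /\ T z != i' :> nat.
  move=> ez zA hxy; have zc : col z < c.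
    by case: hxy; rewrite inE => /andP[]; rewrite ez // -/(col y) /col -e.
  move: zA; rewrite inE zc /= negb_or => /andP[n1 n2].
  by split; [apply: contraNneq n1 | apply: contraNneq n2] => /val_inj ->.
have [xA|xA] := boolP (x \in bkset T); have [yA|yA] := boolP (y \in bkset T).
- rewrite (bk_partner hT xA) ?(bk_partner hT yA) //.
    apply/eqP => yN; have exy := partnerN yN xA e; rewrite exy ltnn in ltT; done.
  apply/eqP => xN; have exy := partnerN xN yA (esym e); rewrite exy ltnn in ltT; done.
- have [n1 n2] := side y (esym e) yA (or_introl xA).
  rewrite (bk_out yA); have := bk_in hT xA; move: xA; rewrite inE.
  by case/andP=> _ /orP[]/eqP eT [] ->; rewrite eT in ltT; lia.
- have [n1 n2] := side x erefl xA (or_intror yA).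
  rewrite (bk_out xA); have := bk_in hT yA; move: yA; rewrite inE.
  by case/andP=> _ /orP[]/eqP eT [] ->; rewrite eT in ltT; lia.
- by rewrite !bk_out.
Qed.

Lemma bk_wt T : ssyt T ->
  weight (fun x => col x < c) (bender_knuth T) =
  [multinom weight (fun x => (col x < c)%R) T (tperm i i' k) | k < n].
Proof.
move=> hT; apply/mnmP => k; rewrite mnmE !weightE.
pose f x := if x \in bkset T then flip row col (bkset T) x else x.
have fK : involutive f.
  move=> x; rewrite {2}/f; case: ifP => xA; last by rewrite /f xA.
  by rewrite /f; have [-> ->] := flipK row (bkset_le2 hT) xA.
have fc x : (col (f x) < c) = (col x < c).
  rewrite /f; case: ifP => xA //.
  have [+ _] := flipK row (bkset_le2 hT) xA.
  by move: xA; rewrite !inE => /andP[-> _] /andP[-> _].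
rewrite [RHS](reindex_inj (inv_inj fK)) /=.
apply: eq_big => x; first by rewrite fc.
move=> xc; congr nat_of_bool; rewrite ffunE /f; case: ifP => xA.
  by rewrite -{1}(tpermK i i' k) (inj_eq perm_inj).
move: xA; rewrite inE xc /= => /negbT; rewrite negb_or => /andP[n1 n2].
by case: tpermP => // ->; rewrite (negPf n1) (negPf n2).
Qed.

End BenderKnuth.
(** * Littlewood-Richardson expansion of skew Schur polynomials *)

(** Turns a filling into a function on all boxes, 0 off D, so that fillings of different diagrams
    can be restricted and compared. *)
Definition entry (D : {fset box}) (n : nat) (T : {ffun D -> 'I_n}) (b : box) : nat :=
  oapp (fun u : D => T u : nat) 0%N (insub b).

Lemma entryE (D : {fset box}) (n : nat) (T : {ffun D -> 'I_n}) (u : D) : entry T (val u) = T u.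
Proof. by rewrite /entry valK. Qed.

Definition count_right (D : {fset box}) (g : box -> nat) (c : int) (k : nat) : nat :=
  (\sum_(b <- D | (c <= b.2)%R) (g b == k))%N.

(* The lattice condition for the column reading (columns from right to left).
   It yields the same numbers as the row reading [lattice], but this is not
   needed: [lrcoef] enters only as the coefficients of a Schur expansion. *)
Definition clattice (D : {fset box}) (g : box -> nat) : Prop :=
  forall c k, (count_right D g c k.+1 <= count_right D g c k)%N.

Lemma count_right_entry (D : {fset box}) (n : nat) (T : {ffun D -> 'I_n}) (c : int) (k : nat) :
  count_right D (entry T) c k = (\sum_(u : D | (c <= (val u).2)%R) (T u == k :> nat))%N.
Proof.
rewrite /count_right big_seq_fsetE /=.
by apply: eq_bigr => u _; rewrite entryE.
Qed.

Lemma count_right_entry_weight (D : {fset box}) (n : nat) (T : {ffun D -> 'I_n}) (c : int) (k : 'I_n) :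
  count_right D (entry T) c k = weight (fun u => (c <= (val u).2)%R) T k.
Proof. by rewrite count_right_entry weightE. Qed.

Lemma count_right_big (D : {fset box}) (n : nat) (T : {ffun D -> 'I_n}) (c : int) (k : nat) :
  (n <= k)%N -> count_right D (entry T) c k = 0%N.
Proof.
move=> nk; rewrite count_right_entry big1 // => u _.
by case: eqP => // e; have := ltn_ord (T u); rewrite e; lia.
Qed.

Lemma eq_count_right (D : {fset box}) (g g' : box -> nat) (c : int) (k : nat) :
  (forall b : box, b \in D -> c <= b.2 -> g b = g' b) -> count_right D g c k = count_right D g' c k.
Proof.
move=> h; rewrite /count_right big_seq_cond [RHS]big_seq_cond; apply: eq_bigr => b /andP[bD bc].
by rewrite h.
Qed.

Lemma weight_split (D : {fset box}) (n : nat) (c : int) (T : {ffun D -> 'I_n}) :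
  weight predT T = (weight (fun u => (c <= (val u).2)%R) T + weight (fun u => ((val u).2 < c)%R) T)%MM.
Proof.
apply/mnmP => k; rewrite mnmDE !weightE (bigID (fun u => (c <= (val u).2)%R)) /=; congr addn.
by apply: eq_bigl => u; rewrite ltNge.
Qed.

Lemma schurE (D : {fset box}) (n : nat) :
  schur D n = \sum_(T : {ffun D -> 'I_n} | ssyt T) 'X_[weight predT T].
Proof. by apply: eq_bigr => T _; rewrite mprodXE. Qed.

Lemma mpoly_eqN0 (n : nat) (p : {mpoly int[n]}) : p = - p -> p = 0.
Proof.
move=> h; apply/mpolyP => m; rewrite mcoeff0.
have : p@_m = - p@_m by rewrite -mcoeffN -h.
lia.
Qed.

Section Stembridge.
Variables (D : {fset box}) (n : nat).
Hypothesis Dconv : convex D.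
Implicit Types (T : {ffun D -> 'I_n}).

Let F T : {mpoly int[n]} := alt 'X_[weight predT T + rho_monom n].

(* The weight left of column c is symmetric in i and i' by the Bender-Knuth
   involution, while rho plus the weight from column c on has equal exponents
   at i and i'; so the alternants cancel in pairs. *)
Lemma bad_class_sum (i i' : 'I_n) (c : int) (Q : pred {ffun D -> 'I_n}) :
  i' = i.+1 :> nat ->
  (forall T, ssyt T -> Q (bender_knuth i i' c T) = Q T) ->
  (forall T, ssyt T -> Q T -> (forall x : D, (val x).2 = c -> T x != i) /\
     count_right D (entry T) c i' = (count_right D (entry T) c i).+1) ->
  \sum_(T | ssyt T && Q T) F T = 0.
Proof.
move=> ii' Qbk hQ; apply: mpoly_eqN0.
pose psi T := if ssyt T && Q T then bender_knuth i i' c T else T.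
have psiP T : ssyt T && Q T -> ssyt (psi T) && Q (psi T).
  move=> h; rewrite /psi h; case/andP: h => hT qT; rewrite Qbk // qT andbT.
  by apply: bk_ssyt => //; case: (hQ _ hT qT).
have psiK : involutive psi.
  move=> T; rewrite {2}/psi; case: ifP => h; last by rewrite /psi h.
  have := psiP _ h; rewrite /psi h => ->; case/andP: h => hT _; exact: bkK.
have psiE T : ssyt (psi T) && Q (psi T) = (ssyt T && Q T).
  by apply/idP/idP => [/psiP|/psiP //]; rewrite psiK.
rewrite {1}(reindex_inj (inv_inj psiK)) /= -sumrN.
apply: eq_big => T; first by rewrite psiE.
rewrite psiE => h; rewrite {1}/psi h; case/andP: h => hT qT.
have [hc hw] := hQ _ hT qT; rewrite !count_right_entry_weight in hw.
rewrite /F (_ : (_ + _)%MM = [multinom (weight predT T + rho_monom n)%MM (tperm i i' k) | k < n]).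
  rewrite -[X in alt X](_ : msym (tperm i i') 'X_[weight predT T + rho_monom n] = _); last first.
    by rewrite msymX tpermV.
  rewrite alt_msym odd_tperm (_ : i != i') ?expr1 ?scaleN1r //.
  by apply: contra_eq_neq ii' => ->; lia.
apply/mnmP => k; rewrite mnmE !mnmDE !(weight_split c) !mnmDE bk_wt // !mnmE.
have -> : weight (fun u => (c <= (val u).2)%R) (bender_knuth i i' c T) = weight (fun u => (c <= (val u).2)%R) T.
  by rewrite /weight; apply: eq_bigr => u /bk_right ->.
have := ltn_ord i'.
by case: tpermP => [->|->|] //; rewrite ?tpermL ?tpermR; lia.
Qed.

Lemma column_le1 (T : {ffun D -> 'I_n}) (c : int) (k : nat) : ssyt T ->
  (\sum_(u : D | (val u).2 == c) (T u == k :> nat) <= 1)%N.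
Proof.
move=> hT; case: (pickP (fun u : D => ((val u).2 == c) && (T u == k :> nat))) => [u /andP[uc uk]|h].
  rewrite (bigD1 u) //= uk big1 // => v /andP[vc vu].
  case: eqP => // vk; case/eqP: vu; apply: (ssyt_col hT); first by rewrite (eqP uc) (eqP vc).
  by apply: val_inj; rewrite /= vk (eqP uk).
by rewrite big1 // => u uc; have := h u; rewrite uc /= => ->.
Qed.

Lemma count_right_col (T : {ffun D -> 'I_n}) (c : int) (k : nat) :
  count_right D (entry T) (c - 1) k =
  (\sum_(u : D | (val u).2 == (c - 1)%R) (T u == k :> nat) + count_right D (entry T) c k)%N.
Proof.
rewrite !count_right_entry (bigID (fun u : D => (val u).2 == (c - 1)%R)) /=; congr addn; apply: eq_bigl => u; lia.
Qed.

Lemma entry_bk (i i' : 'I_n) (c : int) (T : {ffun D -> 'I_n}) (b : box) :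
  b \in D -> c <= b.2 -> entry (bender_knuth i i' c T) b = entry T b.
Proof.
by move=> bD bc; rewrite -[b]/(val [` bD]) !entryE bk_right.
Qed.

Definition clattice_from (c : int) T : Prop :=
  forall c', c <= c' -> forall k, (count_right D (entry T) c' k.+1 <= count_right D (entry T) c' k)%N.

(** Interpolates between [clattice_from c] and [clattice_from (c - 1)], testing the pairs of
    consecutive letters in column c - 1 one at a time. *)
Definition clattice_upto (c : int) (m : nat) T : Prop :=
  clattice_from c T /\
  forall k, (k < m)%N -> (count_right D (entry T) (c - 1) k.+1 <= count_right D (entry T) (c - 1) k)%N.

Lemma clattice_fromS (c : int) T :
  clattice_upto c n T <-> clattice_from (c - 1) T.
Proof.
split=> [[h1 h2] c' lec k|h]; last first.
  by split=> [c' lec k|k _]; apply: h => //; lia.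
have [e|ne] := eqVneq c' (c - 1); last by apply: h1; lia.
rewrite e; have [kn|nk] := ltnP k n; first exact: h2.
by rewrite count_right_big //; lia.
Qed.

(** A column holds each letter at most once. So if the condition first fails at column c - 1 for the
    pair m, m.+1, then m is absent from that column and m.+1 leads by exactly one, which is what
    [bad_class_sum] requires. *)
Lemma stembridge_letter (c : int) (m : nat) : (m < n)%N ->
  \sum_(T | ssyt T && `[< clattice_upto c m T >]) F T =
  \sum_(T | ssyt T && `[< clattice_upto c m.+1 T >]) F T.
Proof.
move=> mn; pose ok T := (count_right D (entry T) (c - 1) m.+1 <= count_right D (entry T) (c - 1) m)%N.
have z : \sum_(T | (ssyt T && `[< clattice_upto c m T >]) && ~~ ok T) F T = 0.
  have [mn'|nm] := ltnP m.+1 n; last first.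
    by apply: big_pred0 => T; rewrite /ok count_right_big // leq0n andbF.
  pose i := Ordinal mn; pose i' := Ordinal mn'.
  rewrite (eq_bigl (fun T => ssyt T && (`[< clattice_upto c m T >] && ~~ ok T))); last first.
    by move=> T; rewrite andbA.
  apply: (@bad_class_sum i i' (c - 1)) => // T hT.
    have ec c' k : c - 1 <= c' -> count_right D (entry (bender_knuth i i' (c - 1) T)) c' k = count_right D (entry T) c' k.
      by move=> lec; apply: eq_count_right => b bD bc; apply: entry_bk => //; apply: le_trans lec bc.
    congr andb; last by rewrite /ok !ec.
    apply/asboolP/asboolP => -[h1 h2]; split=> [c' lec k|k km].
    - by rewrite -!ec; [apply: h1| lia..].
    - by rewrite -!ec //; apply: h2.
    - by rewrite !ec; [apply: h1|lia..].
    - by rewrite !ec //; apply: h2.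
  case/andP => /asboolP[h1 h2]; rewrite /ok -ltnNge => nok.
  have le2 := h1 c (lexx c) m; have le1 := column_le1 (c - 1) m.+1 hT.
  have e : count_right D (entry T) (c - 1) m.+1 = (count_right D (entry T) (c - 1) m).+1.
    by move: nok; rewrite !count_right_col; lia.
  rewrite !count_right_col in nok.
  have z : (\sum_(u : D | (val u).2 == (c - 1)%R) (T u == m :> nat))%N = 0%N by lia.
  split; last exact: e.
  move=> x xc; move/eqP: z; rewrite sum_nat_eq0 => /forallP /(_ x); rewrite xc eqxx /=.
  by apply: contraTneq => ->; rewrite eqxx.
rewrite (bigID ok) /= z addr0.
apply: eq_bigl => T; rewrite -andbA; congr andb; apply/andP/asboolP.
  case=> /asboolP[h1 h2] okT; split=> // k; rewrite ltnS leq_eqVlt.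
  by case/orP => [/eqP ->|]; [exact: okT|exact: h2].
case=> h1 h2; split; last exact: h2.
by apply/asboolP; split=> // k km; apply: h2; lia.
Qed.

Lemma stembridge_column (c : int) :
  \sum_(T | ssyt T && `[< clattice_from c T >]) F T =
  \sum_(T | ssyt T && `[< clattice_from (c - 1) T >]) F T.
Proof.
have h m : (m <= n)%N -> \sum_(T | ssyt T && `[< clattice_from c T >]) F T =
    \sum_(T | ssyt T && `[< clattice_upto c m T >]) F T.
  elim: m => [_|m IH mn]; last exact: etrans (IH (ltnW mn)) (stembridge_letter c mn).
  apply: eq_bigl => T; congr andb; apply/asboolP/asboolP => [h|[]//].
  by split.
apply: etrans (h n (leqnn n)) _; apply: eq_bigl => T; congr andb.
by apply/asboolP/asboolP => /clattice_fromS.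
Qed.

Lemma fset_bound : exists M : nat, forall b : box, b \in D -> - M%:Z < b.2 < M%:Z.
Proof.
exists (\sum_(b <- D) (absz b.2).+1)%N => b bD.
have le : ((absz b.2).+1 <= \sum_(b <- D) (absz b.2).+1)%N.
  by rewrite (big_fsetD1 b) //= leq_addr.
lia.
Qed.

Lemma stembridge :
  \sum_(T | ssyt T) F T = \sum_(T | ssyt T && `[< clattice D (entry T) >]) F T.
Proof.
have [M hM] := fset_bound.
(* The sweep starts to the right of all boxes, where the condition is void, and after M + M columns
   it has passed all of them; further left the counts stay constant. *)
have h d : \sum_(T | ssyt T) F T = \sum_(T | ssyt T && `[< clattice_from (M%:Z - d%:Z) T >]) F T.
  elim: d => [|d IH].
    apply: eq_bigl => T; case: (ssyt T) => //=; apply/esym/asboolP => c' lec k.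
    rewrite /count_right big_seq_cond big1 // => -[x y] /andP[/hM] /=; lia.
  have -> : M%:Z - d.+1%:Z = M%:Z - d%:Z - 1 by lia.
  exact: etrans IH (stembridge_column _).
apply: etrans (h (M + M)%N) _; apply: eq_bigl => T; congr andb.
apply/asboolP/asboolP => [h1 c k|h1 c' _ k]; last exact: h1.
have [/h1//|lt] := leP (M%:Z - (M + M)%N%:Z) c.
have e k' : count_right D (entry T) c k' = count_right D (entry T) (M%:Z - (M + M)%N%:Z) k'.
  rewrite /count_right big_seq_cond [RHS]big_seq_cond; apply: eq_bigl => -[x y].
  case: (boolP ((x, y) \in D)) => //= /hM /= /andP[gt _].
  have ge : M%:Z - (M + M)%N%:Z <= y by lia.
  by rewrite ge (le_trans (ltW lt)).
by rewrite !e; apply: h1.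
Qed.

(** With the cut to the right of all boxes the involution acts on the whole filling and its border
    condition is vacuous. *)
Lemma schur_sym (s : 'S_n) : msym s (schur D n) = schur D n.
Proof.
move: s; apply: symmetric_adjacent => i i' ii'.
have [M hM] := fset_bound.
have hc (x : D) : (val x).2 < M%:Z by case/andP: (hM _ (valP x)).
pose psi T := if ssyt T then bender_knuth i i' M%:Z T else T.
have psiE T : ssyt T -> ssyt (psi T).
  move=> hT; rewrite /psi hT; apply: bk_ssyt => // x e.
  by have := hc x; rewrite e ltxx.
have psiK : involutive psi.
  move=> T; rewrite {2}/psi; case: ifP => h; last by rewrite /psi h.
  by have := psiE _ h; rewrite /psi h => ->; exact: bkK.
rewrite schurE (raddf_sum (msym _)) [RHS](reindex_inj (inv_inj psiK)) /=.
apply: eq_big => T; first by apply/idP/idP => [/psiE//|/psiE]; rewrite psiK.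
move=> hT; rewrite /psi hT msymX tpermV; congr mpolyX.
have e T' : weight predT T' = weight (fun x => ((val x).2 < M%:Z)%R) T'.
  by rewrite /weight; apply: eq_bigl => x; rewrite hc.
by rewrite !e bk_wt.
Qed.

Lemma schur_alt_rho :
  schur D n * alt_rho n = \sum_(T | ssyt T && `[< clattice D (entry T) >]) F T.
Proof.
rewrite -stembridge mulrC /alt_rho -altM; last exact: schur_sym.
rewrite schurE mulr_sumr alt_sum; apply: eq_bigr => T _.
by rewrite -mpolyXD addmC.
Qed.

End Stembridge.
(** * Partitions and Littlewood-Richardson fillings *)

Lemma intpart_nth_le (nu : intpart) (i j : nat) :
  (i <= j)%N -> (nth 0%N nu j <= nth 0%N nu i)%N.
Proof.
move=> ij; have [sj|sj] := ltnP j (size nu); last by rewrite nth_default.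
have /andP[so _] := partsP nu.
have tr : transitive geq by move=> y x z /= xy yz; apply: leq_trans yz xy.
have := sorted_leq_nth tr (fun x => leqnn x) 0%N so.
by apply => //; rewrite inE // (leq_ltn_trans ij sj).
Qed.

Lemma intpart_nth_gt0 (nu : intpart) (i : nat) : (0 < nth 0%N nu i)%N = (i < size nu)%N.
Proof.
case: (ltnP i (size nu)) => si; last by rewrite nth_default.
rewrite lt0n; apply: contraTneq (mem_nth 0%N si) => ->.
by case/andP: (partsP nu).
Qed.

Lemma intpart_eq (mu nu : intpart) : (forall k, nth 0%N mu k = nth 0%N nu k) -> mu = nu.
Proof.
move=> h; apply: val_inj; apply: (@eq_from_nth _ 0%N) => //=.
have e k : (k < size mu)%N = (k < size nu)%N by rewrite -!intpart_nth_gt0 h.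
by apply/eqP; rewrite eqn_leq leqNgt e ltnn leqNgt -e ltnn.
Qed.

Lemma sumn_nth (s : seq nat) (n : nat) : (size s <= n)%N ->
  sumn s = (\sum_(k < n) nth 0%N s k)%N.
Proof.
move=> sn; rewrite sumnE (big_nth 0%N) (big_nat_widen _ _ n) // big_mkord big_mkcond /=.
apply: eq_bigr => i _; by case: ltnP => // ?; rewrite nth_default.
Qed.

Section PartOf.
Variables (w : nat -> nat) (n : nat).
Hypothesis w_decr : forall k, (w k.+1 <= w k)%N.

Lemma part_of_proof : is_intpart [seq x <- mkseq w n | x != 0%N].
Proof.
have tr : transitive geq by move=> y x z /= xy yz; apply: leq_trans yz xy.
rewrite /is_intpart mem_filter eqxx /= andbT; apply: sorted_filter => //.
case: n => [|m] //=; rewrite /mkseq /=; apply/(pathP 0%N) => i.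
rewrite size_map size_iota => im; rewrite (nth_map 0%N) ?size_iota // nth_iota //.
case: i im => [|i] im /=; first exact: w_decr.
by rewrite (nth_map 0%N) ?size_iota ?nth_iota ?w_decr //; lia.
Qed.

Definition part_of : intpart := IntPart part_of_proof.

Lemma size_part_of : (size part_of <= n)%N.
Proof. by rewrite /= size_filter (leq_trans (count_size _ _)) // size_mkseq. Qed.

Lemma nth_part_of k : nth 0%N part_of k = if (k < n)%N then w k else 0%N.
Proof.
have wle i j : (i <= j)%N -> (w j <= w i)%N.
  by elim: j => [|j IH]; [rewrite leqn0 => /eqP ->|rewrite leq_eqVlt => /orP[/eqP ->//|/IH]; apply: leq_trans].
rewrite /=; elim: n => [|m IH]; first by rewrite nth_nil.
rewrite /mkseq -addn1 iotaD map_cat filter_cat nth_cat /= add0n -/(mkseq w m).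
have [w0|wm] := eqVneq (w m) 0%N.
  have e : (if (k < m.+1)%N then w k else 0%N) = (if (k < m)%N then w k else 0%N).
    rewrite ltnS leq_eqVlt; case: (eqVneq k m) => [->|//] /=.
    by rewrite ltnn w0.
  rewrite addn1 e -IH /= nth_nil; case: ltnP => // ?; by rewrite nth_default.
have sz : size [seq x <- mkseq w m | x != 0%N] = m.
  rewrite size_filter -[RHS](size_mkseq w m); apply/eqP; rewrite -all_count.
  apply/allP => _ /mapP[i + ->]; rewrite mem_iota /= => im.
  by have := wle i m (ltnW im); lia.
rewrite sz addn1; case: (ltnP k m) => km; first by rewrite IH km (ltn_trans km).
by case: (ltnP k m.+1) => km1; [rewrite (_ : k = m) ?subnn //; lia|rewrite nth_default //=; lia].
Qed.

End PartOf.

Definition ssytg (D : {fset box}) (g : box -> nat) : Prop :=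
  (forall b b' : box, b \in D -> b' \in D -> b.1 = b'.1 -> b.2 < b'.2 -> (g b <= g b')%N) /\
  (forall b b' : box, b \in D -> b' \in D -> b.2 = b'.2 -> b.1 < b'.1 -> (g b < g b')%N).

Lemma ssytgP (D : {fset box}) (n : nat) (T : {ffun D -> 'I_n}) :
  ssyt T <-> ssytg D (entry T).
Proof.
split=> [/ssytP[h1 h2]|[h1 h2]].
  by split=> b b' bD b'D; rewrite -[b]/(val [` bD]) -[b']/(val [` b'D]) !entryE; [apply: h1|apply: h2].
by apply/ssytP; split=> b b' e lt; rewrite -!entryE; [apply: h1|apply: h2] => //; apply: valP.
Qed.

Definition count_letter (D : {fset box}) (g : box -> nat) (k : nat) : nat :=
  (\sum_(b <- D) (g b == k))%N.

Lemma count_right_count_letter (D : {fset box}) (g : box -> nat) (c : int) (k : nat) :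
  (forall b : box, b \in D -> c <= b.2) -> count_right D g c k = count_letter D g k.
Proof.
move=> h; rewrite /count_right /count_letter big_seq_cond [RHS]big_seq_cond; apply: eq_bigl => b.
by case: (boolP (b \in D)) => //= /h ->.
Qed.

Lemma clattice_count_letter (D : {fset box}) (g : box -> nat) (k : nat) :
  clattice D g -> (count_letter D g k.+1 <= count_letter D g k)%N.
Proof.
move=> h; have [M hM] := fset_bound D.
have hc b : b \in D -> - M%:Z <= b.2 by move=> /hM /andP[/ltW].
by rewrite -!(count_right_count_letter _ _ hc); apply: h.
Qed.

Lemma count_letter_gt0 (D : {fset box}) (g : box -> nat) (b : box) : b \in D -> (0 < count_letter D g (g b))%N.
Proof. by move=> bD; rewrite /count_letter (big_fsetD1 b) //= eqxx. Qed.

Lemma sum_count_letter (D : {fset box}) (g : box -> nat) (n : nat) :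
  (forall b : box, b \in D -> g b < n)%N -> (\sum_(k < n) count_letter D g k)%N = #|` D|.
Proof.
move=> h; rewrite /count_letter exchange_big /= big_seq (eq_bigr (fun=> 1%N)).
  by rewrite -big_seq sum1_size.
move=> b bD; rewrite (bigD1 (Ordinal (h b bD))) //= eqxx big1 // => k kb.
by case: eqP => // e; case/eqP: kb; apply: val_inj.
Qed.

Definition is_lr (D : {fset box}) (nu : seq nat) (g : box -> nat) : Prop :=
  [/\ ssytg D g, clattice D g & forall k, count_letter D g k = nth 0%N nu k].

Lemma is_lr_bound (D : {fset box}) (nu : seq nat) (g : box -> nat) (b : box) :
  is_lr D nu g -> b \in D -> (g b < size nu)%N.
Proof.
case=> _ _ h bD; have := count_letter_gt0 g bD; rewrite h.
by case: (ltnP (g b) (size nu)) => // ?; rewrite nth_default.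
Qed.

Lemma eq_is_lr (D : {fset box}) (nu : seq nat) (g g' : box -> nat) :
  (forall b : box, b \in D -> g b = g' b) -> is_lr D nu g -> is_lr D nu g'.
Proof.
move=> e [[h1 h2] h3 h4]; split.
- by split=> b b' bD b'D; rewrite -!e //; [apply: h1|apply: h2].
- by move=> c k; rewrite -!(eq_count_right (g := g)) // => b bD _; apply: e.
- by move=> k; rewrite -h4 /count_letter big_seq [RHS]big_seq; apply: eq_bigr => b /e ->.
Qed.

Definition lr_set (D : {fset box}) (n : nat) (nu : seq nat) : {set {ffun D -> 'I_n}} :=
  [set T | `[< is_lr D nu (entry T) >]].

Definition lr_col (D : {fset box}) (nu : seq nat) : nat := #|lr_set D (size nu) nu|.

(** Fillings are transported along h; since h reaches every box of S, a filling can be recovered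
    from its transport. With h the identity this changes the alphabet, otherwise the diagram. *)
Lemma lr_card_le (S S' : {fset box}) (n n' : nat) (mu mu' : seq nat) (h : box -> box) :
  (0 < n')%N -> (size mu' <= n')%N ->
  (forall b : box, b \in S -> exists2 b', b' \in S' & h b' = b) ->
  (forall T, T \in lr_set S n mu -> is_lr S' mu' (entry T \o h)) ->
  (#|lr_set S n mu| <= #|lr_set S' n' mu'|)%N.
Proof.
case: n' => // n' _ sn hS hT.
pose f (T : {ffun S -> 'I_n}) : {ffun S' -> 'I_n'.+1} := [ffun u => inord (entry T (h (val u)))].
have ft T b : T \in lr_set S n mu -> b \in S' -> entry (f T) b = entry T (h b).
  move=> /hT TL bS; rewrite -[b]/(val [` bS]) entryE ffunE inordK //=.
  by have := is_lr_bound TL bS; rewrite ltnS /=; lia.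
rewrite -(card_in_imset (f := f)); last first.
  move=> T T' TL T'L e; apply/ffunP => u; apply: val_inj; rewrite /= -!entryE.
  by have [b bS <-] := hS _ (valP u); rewrite -!ft // e.
apply/subset_leq_card/subsetP => _ /imsetP[T TL ->]; rewrite inE; apply/asboolP.
by apply: eq_is_lr (hT _ TL) => b bS; rewrite ft.
Qed.

Lemma lr_set_col (D : {fset box}) (n : nat) (nu : seq nat) :
  (0 < size nu)%N -> (size nu <= n)%N -> #|lr_set D n nu| = lr_col D nu.
Proof.
move=> s0 sn; apply/eqP; rewrite eqn_leq.
by apply/andP; split; apply: (lr_card_le (h := id)) => //; try (by exists b);
  try (by move=> T; rewrite inE => /asboolP); rewrite ?(leq_trans s0) // => b bS; exists b.
Qed.

Lemma mem_ferrers (s : seq nat) (b : box) :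
  reflect (exists i j, (j < nth 0 s i)%N /\ b = (i.+1%:Z, j.+1%:Z)) (b \in ferrers s).
Proof.
rewrite /ferrers in_fset /=; apply: (iffP allpairsPdep) => [[i [j [hi hj ->]]]|[i [j [hj ->]]]].
  by exists i, j; rewrite mem_iota in hj.
exists i, j; split=> //; rewrite mem_iota //= add0n.
by case: (ltnP i (size s)) hj => // ?; rewrite nth_default.
Qed.

Lemma big_ferrers (s : seq nat) (F : box -> nat) :
  (\sum_(b <- ferrers s) F b =
   \sum_(i < size s) \sum_(j < nth 0 s i) F (i.+1%:Z, j.+1%:Z))%N.
Proof.
set l := [seq (i.+1%:Z, j.+1%:Z) | i <- iota 0 (size s), j <- iota 0 (nth 0 s i)].
have pl : perm_eq (ferrers s) l.
  apply: uniq_perm; first exact: fset_uniq.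
    apply: allpairs_uniq_dep => [|i _|]; rewrite ?iota_uniq //.
    by move=> [i j] [i' j'] _ _ /= [-> ->].
  by move=> b; rewrite in_fset.
rewrite (perm_big _ pl) big_allpairs_dep /= -[size s]subn0 -/(index_iota 0 _) big_mkord subn0.
by apply: eq_bigr => i _; rewrite -[nth 0 s i]subn0 -/(index_iota 0 _) big_mkord subn0.
Qed.

Lemma card_ferrers (s : seq nat) : #|` ferrers s| = sumn s.
Proof.
rewrite -sum1_size big_ferrers sumnE (big_nth 0%N) big_mkord.
by apply: eq_bigr => i _; rewrite sum1_card card_ord.
Qed.

Lemma convex_ferrers (nu : intpart) : convex (ferrers nu).
Proof.
move=> _ b' [x y] /mem_ferrers[i [j [_ ->]]] /mem_ferrers[i' [j' [h ->]]] /= hx hy.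
case: x y hx hy => [[|x]|x] [[|y]|y] hx hy; try lia.
apply/mem_ferrers; exists x, y; split=> //.
have xi : (x <= i')%N by lia.
have := intpart_nth_le nu xi; lia.
Qed.

(* A first wrong letter v, in the rightmost possible column and then topmost,
   would have no letter v - 1 weakly to its right. *)
Lemma ferrers_lr_unique (nu : intpart) (g : box -> nat) :
  ssytg (ferrers nu) g -> clattice (ferrers nu) g ->
  forall i j, (j < nth 0%N nu i)%N -> g (i.+1%:Z, j.+1%:Z) = i.
Proof.
move=> [hrow hcol] hl.
have mem i j : (j < nth 0%N nu i)%N -> (i.+1%:Z, j.+1%:Z) \in ferrers nu.
  by move=> h; apply/mem_ferrers; exists i, j.
(* Induction on d treats the columns from right to left; for d = 0 column j lies beyond the first
   row and is empty. *)
suff key d j : (nth 0 nu 0 <= j + d)%N ->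
    forall i, (j < nth 0%N nu i)%N -> g (i.+1%:Z, j.+1%:Z) = i.
  by move=> i j; apply: (key (nth 0%N nu 0)); lia.
elim: d j => [|d IHd] j hj.
  by move=> i; have := intpart_nth_le nu (leq0n i); lia.
elim/ltn_ind => i IHi hi.
have right i' j' : (j < j')%N -> (j' < nth 0%N nu i')%N -> g (i'.+1%:Z, j'.+1%:Z) = i'.
  by move=> jj'; apply: IHd; lia.
have above i' : (i' < i)%N -> g (i'.+1%:Z, j.+1%:Z) = i'.
  move=> ii'; apply: IHi => //; have := intpart_nth_le nu (ltnW ii'); lia.
have ge : (i <= g (i.+1%:Z, j.+1%:Z))%N.
  case: i hi IHi above => [|i] hi IHi above //.
  rewrite -{1}(above i) //; apply: hcol => //=; try exact: mem; last lia.
  by apply: mem; have := intpart_nth_le nu (leqnSn i); lia.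
apply/eqP; rewrite eqn_leq ge andbT leqNgt; apply/negP => gt.
set v := g (i.+1%:Z, j.+1%:Z) in ge gt.
have hj1 : (nth 0%N nu i <= j.+1)%N.
  rewrite leqNgt; apply/negP => lt.
  have := hrow (i.+1%:Z, j.+1%:Z) (i.+1%:Z, j.+2%:Z) (mem _ _ hi) (mem _ _ lt) erefl.
  rewrite (right _ j.+1) // -/v /=; lia.
have : (0 < count_right (ferrers nu) g j.+1%:Z v)%N.
  by rewrite /count_right big_mkcond (big_fsetD1 (i.+1%:Z, j.+1%:Z)) ?mem //= lexx eqxx.
suff z : count_right (ferrers nu) g j.+1%:Z v.-1 = 0%N.
  by have := hl j.+1%:Z v.-1; rewrite z prednK; lia.
rewrite /count_right big_seq_cond big1 // => _ /andP[/mem_ferrers[i' [j' [h ->]]] /= le].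
have [e|ne] := eqVneq j' j; last first.
  rewrite right //; last lia.
  have : (i' < i)%N.
    by rewrite ltnNge; apply/negP => le1; have := intpart_nth_le nu le1; lia.
  by case: eqP => //; lia.
rewrite e in h *; case: (ltngtP i' i) => [lt|lt|->].
- by rewrite above //; case: eqP => //; lia.
- have : (v < g (i'.+1%:Z, j.+1%:Z))%N by apply: hcol => /=; try apply: mem => //; lia.
  by case: eqP => //; lia.
- by case: eqP => // ; rewrite -/v; lia.
Qed.

(** Existence, complementing [ferrers_lr_unique]. The predecessor occurs because rows are numbered
    from 1 and letters from 0. *)
Lemma ferrers_lr_row (nu : intpart) : is_lr (ferrers nu) nu (fun b => (absz b.1).-1).
Proof.
have count_rightE c k : count_right (ferrers nu) (fun b => (absz b.1).-1) c k =
    (\sum_(j < nth 0 nu k | (c <= j.+1%:Z)%R) 1)%N.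
  rewrite /count_right big_mkcond big_ferrers /=.
  have [ks|ks] := ltnP k (size nu).
    rewrite (bigD1 (Ordinal ks)) //= [X in (_ + X)%N]big1 ?addn0.
      by rewrite [RHS]big_mkcond; apply: eq_bigr => j _; rewrite eqxx.
    by move=> i ik; rewrite big1 // => j _; rewrite -[k]/(nat_of_ord (Ordinal ks)) val_eqE (negPf ik) if_same.
  rewrite nth_default // big_ord0 big1 // => i _; rewrite big1 // => j _.
  have -> : (i == k :> nat) = false by apply/negP => /eqP e; have := ltn_ord i; lia.
  by rewrite if_same.
split.
- split=> _ _ /mem_ferrers[i [j [h ->]]] /mem_ferrers[i' [j' [h' ->]]] /=; last lia.
  by move=> [->].
- move=> c k; rewrite !count_rightE; have le := intpart_nth_le nu (leqnSn k).
  rewrite (big_ord_widen_cond _ (fun j => (c <= j.+1%:Z)%R) (fun=> 1%N) le).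
  by rewrite big_mkcond [leqRHS]big_mkcond; apply: leq_sum => j _; case: ifP => // /andP[->].
- move=> k; have c0 b : b \in ferrers nu -> 0 <= b.2 by case/mem_ferrers => i [j [_ ->]].
  by rewrite -(count_right_count_letter _ _ c0) count_rightE sum1_card card_ord.
Qed.

(** * Schur expansion of convex diagrams and linear independence of Schur polynomials *)

Definition part_monom (n : nat) (s : seq nat) : 'X_{1..n} := [multinom nth 0%N s i | i < n].

Lemma part_monom_rho_decr (n : nat) (nu : intpart) (i j : 'I_n) :
  (i < j)%N -> ((part_monom n nu + rho_monom n)%MM j < (part_monom n nu + rho_monom n)%MM i)%N.
Proof.
by apply: rho_decr => {}i {}j ij; rewrite !mnmE intpart_nth_le // ltnW.
Qed.

Lemma weight_count_letter (D : {fset box}) (n : nat) (T : {ffun D -> 'I_n}) (k : 'I_n) :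
  weight predT T k = count_letter D (entry T) k.
Proof.
rewrite weightE /count_letter big_seq_fsetE /=.
by apply: eq_bigr => u _; rewrite entryE.
Qed.

Lemma size_intpart (nu : intpart) : (size nu <= sumn nu)%N.
Proof.
rewrite (sumn_nth (leqnn _)) -[X in (X <= _)%N]card_ord -sum1_card.
by apply: leq_sum => i _; rewrite intpart_nth_gt0.
Qed.

(** The bialternant formula. Of the lattice fillings only the one by row indices survives, and it
    exists only if there are [size nu] letters. *)
Lemma schur_ferrers_alt_rho (nu : intpart) (n : nat) :
  schur (ferrers nu) n * alt_rho n =
  if (size nu <= n)%N then alt 'X_[part_monom n nu + rho_monom n] else 0.
Proof.
rewrite (schur_alt_rho _ (@convex_ferrers nu)).
have uniqT (T : {ffun ferrers nu -> 'I_n}) : ssyt T -> clattice (ferrers nu) (entry T) ->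
    forall u : ferrers nu, T u = (absz (val u).1).-1 :> nat.
  move=> /ssytgP hT hl u; have /mem_ferrers[i [j [h e]]] := valP u.
  by have := ferrers_lr_unique hT hl h; rewrite -e entryE => ->; rewrite e.
have [sn|ns] := leqP (size nu) n; last first.
  apply: big_pred0 => T; apply/negP => /andP[hT /asboolP hl].
  have h0 : (0 < nth 0%N nu n)%N by rewrite intpart_nth_gt0.
  have bD : (n.+1%:Z, 1%:Z) \in ferrers nu by apply/mem_ferrers; exists n, 0%N.
  by have := uniqT T hT hl [` bD]; have := ltn_ord (T [` bD]); rewrite /=; lia.
have hn (u : ferrers nu) : ((absz (val u).1).-1 < n)%N.
  have /mem_ferrers[i [j [h ->]]] /= := valP u.
  by apply: leq_trans sn; rewrite -intpart_nth_gt0; lia.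
pose T0 : {ffun ferrers nu -> 'I_n} := [ffun u => Ordinal (hn u)].
have [h1 h2 h3] : is_lr (ferrers nu) nu (entry T0).
  by apply: eq_is_lr (ferrers_lr_row nu) => b bD; rewrite -[b]/(val [` bD]) entryE ffunE.
rewrite (big_pred1 T0) => [|T /=].
  by congr (alt 'X_[_ + _]); apply/mnmP => k; rewrite weight_count_letter h3 mnmE.
apply/andP/eqP => [[hT /asboolP hl]|->]; last by split; [apply/ssytgP|apply/asboolP].
by apply/ffunP => u; apply: val_inj; rewrite /= (uniqT T) // ffunE.
Qed.

(** If the nonzero letter counts are not weakly decreasing, which cannot happen for lattice
    fillings, the value is the empty partition. *)
Definition content (D : {fset box}) (n : nat) (T : {ffun D -> 'I_n}) : intpart :=
  insubd (IntPart (parts := [::]) isT) [seq x <- mkseq (count_letter D (entry T)) n | x != 0%N].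

Section Content.
Variables (D : {fset box}) (n : nat) (T : {ffun D -> 'I_n}).
Hypothesis hl : clattice D (entry T).

Lemma contentE : content T = part_of n (fun k => clattice_count_letter k hl).
Proof. by apply: val_inj; rewrite val_insubd part_of_proof // => k; apply: clattice_count_letter. Qed.

Lemma entry_lt b : b \in D -> (entry T b < n)%N.
Proof. by move=> bD; rewrite -[b]/(val [` bD]) entryE. Qed.

Lemma content_nth k : nth 0%N (content T) k = count_letter D (entry T) k.
Proof.
rewrite contentE nth_part_of; case: ltnP => // nk; rewrite /count_letter big_seq big1 // => b /entry_lt.
by case: eqP => //; lia.
Qed.

Lemma size_content : (size (content T) <= n)%N.
Proof. by rewrite contentE size_part_of. Qed.

Lemma sumn_content : sumn (content T) = #|` D|.
Proof.
rewrite (sumn_nth size_content) -(sum_count_letter (g := entry T) (n := n)); last exact: entry_lt.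
by apply: eq_bigr => k _; rewrite content_nth.
Qed.

End Content.

Lemma is_lrP (D : {fset box}) (n : nat) (T : {ffun D -> 'I_n}) (nu : intpart) :
  is_lr D nu (entry T) <-> [/\ ssyt T, clattice D (entry T) & content T = nu].
Proof.
split=> [[/ssytgP h1 h2 h3]|[/ssytgP h1 h2 <-]].
  by split=> //; apply: intpart_eq => k; rewrite content_nth.
by split=> // k; rewrite content_nth.
Qed.

Lemma schur_lr (D : {fset box}) (n : nat) : convex D ->
  schur D n = \sum_(T : {ffun D -> 'I_n} | ssyt T && `[< clattice D (entry T) >])
     schur (ferrers (content T)) n.
Proof.
move=> cD; apply: (mulIf (alt_rho_neq0 n)); rewrite schur_alt_rho // mulr_suml.
apply: eq_bigr => T /andP[_ /asboolP hl].
rewrite schur_ferrers_alt_rho size_content //; congr (alt 'X_[_ + _]).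
by apply/mnmP => k; rewrite weight_count_letter mnmE content_nth.
Qed.

Lemma schur_ferrers_eq0 (nu : intpart) (n : nat) :
  (n < size nu)%N -> schur (ferrers nu) n = 0.
Proof.
move=> sn; apply: (mulIf (alt_rho_neq0 n)).
by rewrite schur_ferrers_alt_rho leqNgt sn mul0r.
Qed.

Lemma sum_by_content (D : {fset box}) (n : nat) (V : nmodType) (F : intpart -> V)
    (P : pred {ffun D -> 'I_n}) :
  (forall T, P T -> clattice D (entry T)) ->
  \sum_(T | P T) F (content T) =
  \sum_(nu <- intparts_of #|` D|) F nu *+ #|[set T | P T && (content T == nu)]|.
Proof.
move=> hP.
rewrite (eq_bigr (fun T => \sum_(nu <- intparts_of #|` D| | nu == content T) F nu)).
  rewrite (exchange_big_dep predT) //=; apply: eq_bigr => nu _.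
  rewrite -sumr_const; apply: eq_bigl => T; rewrite inE; congr andb; exact: eq_sym.
move=> T /hP hl; rewrite big_mkcond (bigD1_seq (content T)) ?intparts_of_uniq //=.
  by rewrite eqxx big1 ?addr0 // => nu /negPf ->.
by rewrite mem_intparts_of sumn_content.
Qed.

Lemma intpart_pos_size (D : {fset box}) (nu : intpart) :
  D != fset0 -> nu \in intparts_of #|` D| -> (0 < size nu)%N.
Proof.
rewrite -cardfs_gt0 mem_intparts_of => D0 /eqP e; rewrite -e in D0.
by case: (parts nu) D0.
Qed.

Lemma card_lr_content (D : {fset box}) (n : nat) (nu : intpart) :
  D != fset0 -> nu \in intparts_of #|` D| -> (size nu <= n)%N ->
  #|[set T : {ffun D -> 'I_n} | (ssyt T && `[< clattice D (entry T) >]) && (content T == nu)]|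
   = lr_col D nu.
Proof.
move=> D0 nuD sn; rewrite -(lr_set_col _ (intpart_pos_size D0 nuD) sn).
apply: eq_card => T; rewrite !inE; apply/andP/asboolP => [[/andP[h1 /asboolP h2] /eqP h3]|].
  exact/is_lrP.
by case/is_lrP => h1 h2 h3; split; [rewrite h1; apply/asboolP|apply/eqP].
Qed.

Lemma schur_lr_col (D : {fset box}) (n : nat) : convex D -> D != fset0 ->
  schur D n = \sum_(nu <- intparts_of #|` D|) schur (ferrers nu) n *+ lr_col D nu.
Proof.
move=> cD D0; rewrite schur_lr // (sum_by_content (fun nu => schur (ferrers nu) n)).
  rewrite big_seq [RHS]big_seq; apply: eq_bigr => nu nuD.
  (* For n below [size nu] the two numbers of fillings may differ, but the Schur polynomial they
     multiply is 0. *)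
  have [sn|ns] := leqP (size nu) n; first by rewrite card_lr_content.
  by rewrite schur_ferrers_eq0 // !mul0rn.
by move=> T /andP[_ /asboolP].
Qed.

(* The coefficient of x^(mu + rho) in f times the alternant of rho extracts s_mu from f. *)
Lemma schur_free (d : nat) (z : intpart -> int) :
  \sum_(nu <- intparts_of d) z nu *: schur (ferrers nu) d = 0 ->
  forall nu, nu \in intparts_of d -> z nu = 0.
Proof.
move=> /(congr1 (fun p => p * alt_rho d)) + mu muD; rewrite mul0r mulr_suml.
have sz nu : nu \in intparts_of d -> (size nu <= d)%N.
  by rewrite mem_intparts_of => /eqP <-; apply: size_intpart.
move/(congr1 (mcoeff (part_monom d mu + rho_monom d))); rewrite mcoeff0 raddf_sum /= => <-.
rewrite (bigD1_seq mu) ?intparts_of_uniq //= -scalerAl mcoeffZ schur_ferrers_alt_rho sz //.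
rewrite mcoeff_alt ?eqxx ?mulr1; try exact: part_monom_rho_decr.
rewrite big_seq_cond big1 ?addr0 // => nu /andP[nuD numu].
rewrite -scalerAl mcoeffZ schur_ferrers_alt_rho sz // mcoeff_alt; try exact: part_monom_rho_decr.
case: eqP => [e|_]; last by rewrite mulr0.
case/eqP: numu; apply: intpart_eq => k.
have [kd|dk] := ltnP k d.
  by move/mnmP/(_ (Ordinal kd)): e; rewrite !mnmDE !mnmE /=; lia.
by rewrite !nth_default // (leq_trans _ dk) ?sz.
Qed.
(** * Diagrams with boxes placed below them *)

Lemma bottom_leftP (D : {fset box}) : D != fset0 ->
  bottom_left D \in D /\
  forall b : box, b \in D -> b.1 < (bottom_left D).1 \/
    b.1 = (bottom_left D).1 /\ (bottom_left D).2 <= b.2.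
Proof.
case/fset0Pn => b0 b0D; rewrite /bottom_left; case: pickP => [b /forallP h|none] /=.
  split=> [|b' b'D]; first exact: valP.
  by have /orP[lt|/andP[/eqP]] := h [` b'D]; [left|right].
pose u0 : D := [` b0D].
have [u _ hu] := arg_maxP (P := predT) (fun x : D => (val x).1) (erefl : predT u0).
have [v /eqP vu hv] := arg_minP (P := fun x : D => (val x).1 == (val u).1)
  (fun x : D => (val x).2) (eqxx _ : (fun x : D => (val x).1 == (val u).1) u).
have := none v; case/negP; apply/forallP => w; rewrite vu.
have le : (val w).1 <= (val u).1 by apply: hu.
have [lt|e] : (val w).1 < (val u).1 \/ (val w).1 == (val u).1 by lia.
  by rewrite lt.
by apply/orP; right; rewrite e; apply: hv.
Qed.

Lemma bottom_left_eq (D : {fset box}) (b : box) : b \in D ->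
  (forall b' : box, b' \in D -> b'.1 < b.1 \/ b'.1 = b.1 /\ b.2 <= b'.2) ->
  bottom_left D = b.
Proof.
move=> bD hb; have D0 : D != fset0 by apply/fset0Pn; exists b.
have [blD hbl] := bottom_leftP D0.
have := hb _ blD; have := hbl _ bD.
case: (bottom_left D) b {hb hbl bD blD} => [r c] [r' c'] /=.
move=> [lt|[e1 le1]] [lt'|[e2 le2]]; try lia.
by rewrite e2; congr pair; apply/le_anti; rewrite le1 le2.
Qed.

(** A box further to the left would, by convexity, force a box of the bottom row to the left of its
    leftmost one. *)
Lemma bottom_left_col (D : {fset box}) (b : box) : convex D -> b \in D ->
  (bottom_left D).2 <= b.2.
Proof.
move=> cD bD; have D0 : D != fset0 by apply/fset0Pn; exists b.
have [blD hbl] := bottom_leftP D0.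
case: (hbl _ bD) => [lt|[]//]; rewrite leNgt; apply/negP => lt2.
have xD : ((bottom_left D).1, b.2) \in D by apply: (cD _ _ _ bD blD) => /=; lia.
by case: (hbl _ xD) => /=; [rewrite ltxx|case; lia].
Qed.

Lemma last_rowP (D : {fset box}) (i : nat) : convex D -> D != fset0 ->
  (i < last_row_length D)%N -> ((bottom_left D).1, (bottom_left D).2 + i%:Z) \in D.
Proof.
move=> cD D0; have [blD hbl] := bottom_leftP D0; apply: contraTT => niD.
rewrite -leqNgt /last_row_length.
case: (bottom_left D) blD hbl niD => [r c] /= blD hbl niD.
set L := [fset b in D | _].
have sub : {subset enum_fset L <= [seq (r, c + k%:Z) | k <- iota 0 i]}.
  move=> [r' c']; rewrite !inE /= => /andP[bD /eqP br]; rewrite br in bD *.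
  have [lt|[_ ge]] := hbl _ bD; first by rewrite /= ltxx in lt.
  rewrite /= in ge.
  apply/mapP; exists (absz (c' - c)); last by congr pair; lia.
  rewrite mem_iota /= add0n; suff : c' < c + i%:Z by lia.
  rewrite ltNge; apply/negP => le; case/negP: niD.
  by apply: (cD _ _ _ blD bD) => /=; lia.
by have := uniq_leq_size (fset_uniq _) sub; rewrite size_map size_iota.
Qed.

Lemma ferrers_down (nu : intpart) (b x : box) : x \in ferrers nu ->
  1 <= b.1 <= x.1 -> 1 <= b.2 <= x.2 -> b \in ferrers nu.
Proof.
move=> xnu h1 h2; have [i [j [hj e]]] := mem_ferrers _ _ xnu.
have one : (1%:Z, 1%:Z) \in ferrers nu.
  by apply/mem_ferrers; exists 0%N, 0%N; split=> //; have := intpart_nth_le nu (leq0n i); lia.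
exact: (convex_ferrers one xnu).
Qed.

Lemma convex_skew (rho kappa : intpart) : convex (skew_diagram rho kappa).
Proof.
move=> b b' x; rewrite !in_fsetD => /andP[bender_knuth br] /andP[_ b'r] h1 h2.
rewrite (convex_ferrers br b'r) // andbT; apply: contra bender_knuth => xk.
have /mem_ferrers[i [j [_ e]]] := br.
by apply: (ferrers_down xk); rewrite e in h1 h2 *; move: h1 h2 => /=; lia.
Qed.

Lemma mem_rot180 (D : {fset box}) (b : box) : (b \in rot180 D) = ((- b.1, - b.2) \in D).
Proof.
apply/imfsetP/idP => [[[x y] /= xD ->]|bD] /=; first by rewrite !opprK.
by exists (- b.1, - b.2) => //=; rewrite !opprK; case: b {bD}.
Qed.

Lemma convex_rot180 (D : {fset box}) : convex D -> convex (rot180 D).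
Proof.
move=> cD b b' x; rewrite !mem_rot180 => bD b'D h1 h2.
by apply: (cD _ _ _ b'D bD) => /=; lia.
Qed.

Lemma card_rot180 (D : {fset box}) : #|` rot180 D| = #|` D|.
Proof. by apply: card_in_imfset => -[x y] [x' y'] _ _ [/oppr_inj -> /oppr_inj ->]. Qed.

(** Rotation reverses rows and columns, so the letters are reversed as well; the resulting
    permutation of the variables is absorbed by the symmetry of [schur D n]. *)
Lemma schur_rot180 (D : {fset box}) (n : nat) : convex D ->
  schur (rot180 D) n = schur D n.
Proof.
move=> cD.
have psiP (u : rot180 D) : (- (val u).1, - (val u).2) \in D by rewrite -mem_rot180 (valP u).
pose psi (u : rot180 D) : D := [` psiP u].
have psi_inj : injective psi.
  move=> u v /(congr1 val) /= [/oppr_inj e1 /oppr_inj e2]; exact: rc_inj.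
have psi_bij : bijective psi.
  by apply: inj_card_bij => //; rewrite -!cardfE card_rot180.
pose f (T : {ffun D -> 'I_n}) : {ffun rot180 D -> 'I_n} := [ffun u => rev_ord (T (psi u))].
have f_inj : injective f.
  move=> T T' e; apply/ffunP => v; have [psi' _ psiK] := psi_bij.
  by rewrite -(psiK v); apply: rev_ord_inj; have/ffunP/(_ (psi' v)) := e; rewrite !ffunE.
have f_bij : bijective f.
  by apply: inj_card_bij => //; rewrite !card_ffun -!cardfE card_rot180.
have fs T : ssyt (f T) = ssyt T.
  have [psi' psi'K psiK] := psi_bij.
  have e1 v : (val (psi' v)).1 = - (val v).1 by rewrite -{2}(psiK v) /= opprK.
  have e2 v : (val (psi' v)).2 = - (val v).2 by rewrite -{2}(psiK v) /= opprK.
  have fE v : f T (psi' v) = rev_ord (T v) by rewrite ffunE psiK.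
  apply/ssytP/ssytP => -[h1 h2]; split=> u v e lt.
  - have := h1 (psi' v) (psi' u); rewrite !e1 !e2 e ltrN2 !fE /= => /(_ erefl lt).
    have := ltn_ord (T u); have := ltn_ord (T v); lia.
  - have := h2 (psi' v) (psi' u); rewrite !e1 !e2 e ltrN2 !fE /= => /(_ erefl lt).
    have := ltn_ord (T u); have := ltn_ord (T v); lia.
  - rewrite !ffunE /=; apply: leq_sub2l; rewrite ltnS; apply: h1 => /=; first by rewrite e.
    by rewrite ltrN2.
  - rewrite !ffunE /=; have : (T (psi v) < T (psi u))%N.
      by apply: h2 => /=; rewrite ?e ?ltrN2.
    have := ltn_ord (T (psi u)); lia.
pose s : 'S_n := perm (@rev_ord_inj n).
rewrite -[RHS](schur_sym cD s) !schurE (raddf_sum (msym s)).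
rewrite (reindex f) /=; last exact: onW_bij.
apply: eq_big => [T|T _]; first by rewrite fs.
rewrite msymX; congr mpolyX; apply/mnmP => k; rewrite mnmE !weightE.
rewrite [RHS](reindex psi) /=; last exact: onW_bij.
apply: eq_bigr => u _; rewrite ffunE; congr nat_of_bool.
rewrite -[k in LHS](permKV s) permE (inj_eq rev_ord_inj) //.
Qed.

(* S arises from D by adjoining the m boxes f 0, ..., f (m - 1). *)
Definition is_ext (S D : {fset box}) (m : nat) (f : nat -> box) : Prop :=
  [/\ forall b : box, b \in S <-> (b \in D \/ exists2 j, (j < m)%N & b = f j),
      forall j j', f j = f j' -> j = j' & forall j, f j \notin D].

Section Extension.
Variables (S D : {fset box}) (m : nat) (f : nat -> box).
Hypothesis ext : is_ext S D m f.

Lemma big_ext (R : Type) (idx : R) (op : Monoid.com_law idx) (F : box -> R) :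
  \big[op/idx]_(b <- S) F b =
  op (\big[op/idx]_(b <- D) F b) (\big[op/idx]_(j < m) F (f j)).
Proof.
have [hS f_inj fD] := ext.
rewrite -(big_mkord predT (fun j => F (f j))) /index_iota subn0.
rewrite -(big_map f predT F) -big_cat; apply: perm_big; apply: uniq_perm.
- exact: fset_uniq.
- rewrite cat_uniq fset_uniq map_inj_uniq ?iota_uniq // andbT /=.
  by apply/hasPn => _ /mapP[j _ ->].
move=> b; rewrite mem_cat; apply/idP/orP => [/hS[|[j jm ->]]|[bD|/mapP[j + ->]]].
- by left.
- by right; apply: map_f; rewrite mem_iota.
- by apply/hS; left.
- by rewrite mem_iota => jm; apply/hS; right; exists j.
Qed.

Lemma card_ext : #|` S| = (#|` D| + m)%N.
Proof. by rewrite -!sum1_size big_ext sum1_card card_ord. Qed.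

Lemma count_right_ext (g : box -> nat) (c : int) (k : nat) :
  count_right S g c k = (count_right D g c k + \sum_(j < m | (c <= (f j).2)%R) (g (f j) == k))%N.
Proof. by rewrite /count_right big_mkcond big_ext -!big_mkcond. Qed.

Lemma count_letter_ext (g : box -> nat) (k : nat) :
  count_letter S g k = (count_letter D g k + \sum_(j < m) (g (f j) == k))%N.
Proof. by rewrite /count_letter big_ext. Qed.

Definition strict_word (n : nat) (x : {ffun 'I_m -> 'I_n}) : bool :=
  [forall i : 'I_m, forall j : 'I_m, (i < j)%N ==> (x i < x j)%N].

(** The hypotheses say that the new boxes form a column disconnected from D; the second factor is
    the elementary symmetric polynomial of degree m. *)
Lemma schur_ext (n : nat) :
  (forall (b : box) (j : nat), b \in D -> b.1 != (f j).1 /\ b.2 != (f j).2) ->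
  (forall i j, (f i).2 = (f j).2 /\ ((f i).1 < (f j).1) = (i < j)%N) ->
  schur S n = schur D n * \sum_(x : {ffun 'I_m -> 'I_n} | strict_word x) \prod_j 'X_(x j).
Proof.
have [hS f_inj fD] := ext => hD hf.
have inlP (u : D) : val u \in S by apply/hS; left; apply: valP.
have inrP (j : 'I_m) : f j \in S by apply/hS; right; exists j.
pose h (T : {ffun S -> 'I_n}) : {ffun D -> 'I_n} * {ffun 'I_m -> 'I_n} :=
  ([ffun u => T [` inlP u]], [ffun j => T [` inrP j]]).
have h_inj : injective h.
  move=> T T' [/ffunP e1 /ffunP e2]; apply/ffunP => s.
  have := valP s; rewrite hS => -[sD|[j jm e]].
    have := e1 [` sD]; rewrite !ffunE.
    by rewrite (_ : [` inlP _] = s) //; apply: val_inj.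
  have := e2 (Ordinal jm); rewrite !ffunE.
  by rewrite (_ : [` inrP _] = s) //; apply: val_inj.
have h_bij : bijective h.
  apply: inj_card_bij => //.
  by rewrite card_prod !card_ffun -!cardfE card_ext !card_ord expnD.
have totl T (b : box) : b \in D -> entry (h T).1 b = entry T b.
  move=> bD; rewrite -[b]/(val [` bD]) entryE ffunE -entryE //.
have totr T (j : 'I_m) : (h T).2 j = entry T (f j) :> nat by rewrite ffunE -entryE.
have hs T : ssyt T = ssyt (h T).1 && strict_word (h T).2.
  apply/idP/andP => [/ssytgP[h1 h2]|[/ssytgP[h1 h2] /forallP h3]].
    split.
      apply/ssytgP; split=> b b' bD b'D; rewrite !totl //; [apply: h1|apply: h2]; by apply/hS; left.
    apply/forallP => i; apply/forallP => j; apply/implyP => ij; rewrite !totr.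
    by apply: h2; try (by apply: inrP); case: (hf i j) => // _ ->.
  apply/ssytgP; split=> b b' /hS[bD|[j jm ->]] /hS[b'D|[j' jm' ->]] e.
  - by rewrite -!totl //; apply: h1.
  - by case: (hD b j' bD) => /eqP.
  - by case: (hD b' j b'D) => /eqP; rewrite e.
  - by case: (hf j j') => ->; rewrite ltxx.
  - by rewrite -!totl //; apply: h2.
  - by case: (hD b j' bD) => _ /eqP.
  - by case: (hD b' j b'D) => _ /eqP; rewrite e.
  - case: (hf j j') => _ -> lt; have /forallP/(_ (Ordinal jm')) := h3 (Ordinal jm).
    by rewrite lt /= !totr.
rewrite /schur big_distrlr /= pair_big_dep /= (reindex h) /=; last exact: onW_bij.
apply: eq_big => [T|T _]; first exact: hs.
pose G (b : box) : {mpoly int[n]} := oapp (fun u : S => 'X_(T u)) 1 (insub b).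
have GE (u : S) : G (val u) = 'X_(T u) by rewrite /G valK.
rewrite (eq_bigr (fun u : S => G (val u))) => [|u _]; last by rewrite GE.
rewrite -(big_seq_fsetE _ _ predT G) /= big_ext /=; congr (_ * _).
  by rewrite big_seq_fsetE /=; apply: eq_bigr => u _; rewrite ffunE -GE.
by apply: eq_bigr => j _; rewrite ffunE -GE.
Qed.

End Extension.

(** Because k = 1, the box with index 0 juts out to the left, and the one with index j.+1 is below
    position j, counted from 0, of the bottom row. *)
Definition rowbox (D : {fset box}) (j : nat) : box :=
  ((bottom_left D).1 + 1, (bottom_left D).2 - 1 + j%:Z).

Definition colbox (D : {fset box}) (j : nat) : box :=
  ((bottom_left D).1 + 1 + j%:Z, (bottom_left D).2 - 1).

Lemma row_ext (D : {fset box}) (m : nat) : convex D -> D != fset0 ->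
  is_ext (place_below [:: m] D 1) D m (rowbox D).
Proof.
move=> cD D0; have [blD hbl] := bottom_leftP D0.
rewrite /place_below /rowbox; case: (bottom_left D) blD hbl => [r c] /= blD hbl; split.
- move=> b; rewrite in_fsetU; split.
    case/orP => [->|/imfsetP[x /= /mem_ferrers[i [j [h ->]]] ->]]; first by left.
    by case: i h => [|i] //= h; [right; exists j => //; congr pair; lia|rewrite nth_nil in h].
  case=> [->//|[j jm ->]]; apply/orP; right; apply/imfsetP; exists (1%:Z, j.+1%:Z) => /=.
    by apply/mem_ferrers; exists 0%N, j.
  by congr pair; lia.
- by move=> j j' [] /eqP; lia.
- by move=> j; apply/negP => /hbl /=; lia.
Qed.

Lemma col_ext (D : {fset box}) (m : nat) : convex D -> D != fset0 ->
  is_ext (place_below (nseq m 1%N) D 1) D m (colbox D).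
Proof.
move=> cD D0; have [blD hbl] := bottom_leftP D0.
rewrite /place_below /colbox; case: (bottom_left D) blD hbl => [r c] /= blD hbl; split.
- move=> b; rewrite in_fsetU; split.
    case/orP => [->|/imfsetP[x /= /mem_ferrers[i [j [h ->]]] ->]]; first by left.
    rewrite nth_nseq in h; case: ifP h => // im h.
    by right; exists i => //=; congr pair; lia.
  case=> [->//|[j jm ->]]; apply/orP; right; apply/imfsetP; exists (j.+1%:Z, 1%:Z) => /=.
    by apply/mem_ferrers; exists j, 0%N; rewrite nth_nseq jm.
  by congr pair; lia.
- by move=> j j' [] /eqP; lia.
- by move=> j; apply/negP => /hbl /=; lia.
Qed.

Lemma colbox_sep (D : {fset box}) (b : box) (j : nat) : convex D -> b \in D ->
  b.1 < (colbox D j).1 /\ (colbox D j).2 < b.2.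
Proof.
move=> cD bD; have D0 : D != fset0 by apply/fset0Pn; exists b.
have [blD hbl] := bottom_leftP D0; have := bottom_left_col cD bD; rewrite /=.
by case: (hbl _ bD) => [?|[? ?]] ?; split; lia.
Qed.

Lemma schur_place_col (D : {fset box}) (m n : nat) : convex D -> D != fset0 ->
  schur (place_below (nseq m 1%N) D 1) n =
  schur D n * \sum_(x : {ffun 'I_m -> 'I_n} | strict_word x) \prod_j 'X_(x j).
Proof.
move=> cD D0; apply: (schur_ext (col_ext m cD D0)).
  by move=> b j bD; case: (colbox_sep j cD bD); lia.
by move=> i j /=; split=> //; lia.
Qed.

Lemma convex_place_col (D : {fset box}) (m : nat) : convex D -> D != fset0 ->
  convex (place_below (nseq m 1%N) D 1).
Proof.
move=> cD D0; have [hS _ _] := col_ext m cD D0.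
have [blD hbl] := bottom_leftP D0.
move=> b b' x /hS[bD|[j jm ->]] /hS[b'D|[j' jm' ->]] h1 h2; apply/hS.
- by left; apply: (cD _ _ _ bD b'D).
- by have := colbox_sep j' cD bD; lia.
- by have := colbox_sep j cD b'D; lia.
- right; exists (absz (x.1 - ((bottom_left D).1 + 1))%R); first by move: h1 => /=; lia.
  by case: x h1 h2 => [a b1] /= ? ?; congr pair; lia.
Qed.

Lemma convex_place_row (D : {fset box}) (m : nat) : convex D -> D != fset0 ->
  (m - 1 <= last_row_length D)%N -> convex (place_below [:: m] D 1).
Proof.
move=> cD D0 mD; have [hS _ _] := row_ext m cD D0.
have [blD hbl] := bottom_leftP D0.
have below (b : box) : b \in D -> b.1 <= (bottom_left D).1 by move=> /hbl; lia.
move=> b b' x /hS[bD|[j jm ->]] /hS[b'D|[j' jm' ->]] h1 h2; apply/hS.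
- by left; apply: (cD _ _ _ bD b'D).
- have cb := bottom_left_col cD bD; move: h1 h2 => /= h1 h2.
  have [e|ne] := eqVneq x.1 ((bottom_left D).1 + 1).
    right; exists (absz (x.2 - ((bottom_left D).2 - 1))%R); first by lia.
    by case: x e h1 h2 => [a b1] /= ? ? ?; congr pair; lia.
  (* The length bound puts the box of the bottom row in the column of x into D, and x lies between b
     and that box. *)
  left; have lD := @last_rowP D (absz (x.2 - (bottom_left D).2)%R) cD D0.
  have {}lD : ((bottom_left D).1, x.2) \in D.
    have e2 : (bottom_left D).2 + (absz (x.2 - (bottom_left D).2)%R)%:Z = x.2 by lia.
    by rewrite e2 in lD; apply: lD; lia.
  by apply: (cD _ _ _ bD lD) => /=; lia.
- by have := below _ b'D; move: h1 => /=; lia.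
- right; exists (absz (x.2 - ((bottom_left D).2 - 1))%R); first by move: h2 => /=; lia.
  by case: x h1 h2 => [a b1] /= ? ?; congr pair; lia.
Qed.
(** * Fillings of a diagram with a row below it *)

Section RowExtension.
Variables (S D : {fset box}) (m : nat) (f : nat -> box) (r c0 : int) (g : box -> nat).
Hypotheses (ext : is_ext S D m f) (fE : forall j, f j = (r, c0 + j%:Z)).
Hypothesis Dbelow : forall b : box, b \in D -> b.1 < r /\ c0 <= b.2.
Hypotheses (gs : ssytg S g) (gl : clattice S g).

Let rowcnt (k : nat) : nat := (\sum_(j < m) (g (f j) == k))%N.

Lemma ext_sub (b : box) : b \in D -> b \in S.
Proof. by case: ext => h _ _ bD; apply/h; left. Qed.

Lemma ext_row (j : nat) : (j < m)%N -> f j \in S.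
Proof. by case: ext => h _ _ jm; apply/h; right; exists j. Qed.

Lemma row_mono (i j : nat) : (i <= j)%N -> (j < m)%N -> (g (f i) <= g (f j))%N.
Proof.
move=> ij jm; move: (ij); rewrite leq_eqVlt => /orP[/eqP ->//|lt].
apply: gs.1; [exact: ext_row (leq_ltn_trans ij jm)|exact: ext_row| |]; rewrite !fE //=; lia.
Qed.

Lemma ext_ssytg : ssytg D g.
Proof.
case: gs => h1 h2; split=> b b' bD b'D; [apply: h1|apply: h2]; exact: ext_sub.
Qed.

(** The row has a box in the column of b, weakly to the left of [f j]: compare down the column, then
    along the row. *)
Lemma ext_below (b : box) (j : nat) : b \in D -> (j < m)%N -> b.2 <= c0 + j%:Z ->
  (g b < g (f j))%N.
Proof.
move=> bD jm le; have [b1 b2] := Dbelow bD.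
have [i ei] : exists i : nat, b.2 = c0 + i%:Z by exists (absz (b.2 - c0)%R); lia.
have ij : (i <= j)%N by lia.
apply: leq_trans (row_mono ij jm); apply: gs.2; rewrite ?fE //=; first exact: ext_sub.
by rewrite -fE; exact: ext_row (leq_ltn_trans ij jm).
Qed.

Lemma count_right_mono (A : {fset box}) (h : box -> nat) (c c' : int) (k : nat) :
  c <= c' -> (count_right A h c' k <= count_right A h c k)%N.
Proof.
move=> cc'; rewrite /count_right big_mkcond [leqRHS]big_mkcond; apply: leq_sum => b _.
by case: ifP => // le; rewrite (le_trans cc' le).
Qed.

Lemma count_right_eq_row0 (c : int) (k : nat) :
  (forall j, (j < m)%N -> c <= c0 + j%:Z -> g (f j) <> k) ->
  (count_right D g c k.+1 <= count_right D g c k)%N.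
Proof.
move=> h; have := gl c k; rewrite !(count_right_ext ext).
rewrite [X in (_ <= _ + X)%N]big1 => [|j]; first by rewrite addn0; apply: leq_trans (leq_addr _ _).
by rewrite fE /= => le; case: eqP => // e; case: (h j (ltn_ord j) le); rewrite fE.
Qed.

(* Letters of D above the last row are smaller than those of the row to their
   right, so removing the row cannot destroy the lattice condition. *)
Lemma ext_clattice : clattice D g.
Proof.
move=> c k; pose P j := [&& (j < m)%N, c <= c0 + j%:Z & g (f j) == k].
have [[j0 hj0]|none] := pselect (exists j, P j); last first.
  by apply: count_right_eq_row0 => j jm le e; apply: none; exists j; rewrite /P jm le e eqxx.
have ub j : P j -> (j <= m)%N by case/and3P => /ltnW.
(* j1 is the rightmost k of the row from column c on. Beyond it the row contributes no k; in the
   columns up to it the letters of D are smaller than k, so moving the column past j1 loses no k.+1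
   of D. *)
case: (ex_maxnP (ex_intro _ j0 hj0) ub) => j1 /and3P[jm le /eqP e] max1.
have h1 : (count_right D g (c0 + j1.+1%:Z) k.+1 <= count_right D g (c0 + j1.+1%:Z) k)%N.
  apply: count_right_eq_row0 => j jm2 le2 e2.
  have /max1 : P j by rewrite /P jm2 e2 eqxx andbT; lia.
  lia.
have -> : count_right D g c k.+1 = count_right D g (c0 + j1.+1%:Z) k.+1.
  rewrite /count_right big_mkcond [RHS]big_mkcond big_seq [RHS]big_seq; apply: eq_bigr => -[x y] bD /=.
  case: ifP => cy; case: ifP => cy2 //.
    have := ext_below bD jm; rewrite e /= => /(_ _) lt.
    by case: eqP => // e2; have := lt; rewrite e2; lia.
  by move: cy cy2; lia.
by apply: leq_trans h1 (count_right_mono _ _ _ _); lia.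
Qed.

(* The letters k.+1 of the last row are confronted, in the column of the
   leftmost of them, with the letters k of D, all of which lie to the right. *)
Lemma row_horizontal_strip (k : nat) : (count_letter D g k.+1 + rowcnt k.+1 <= count_letter D g k)%N.
Proof.
pose P j := (j < m)%N && (g (f j) == k.+1).
have [ex|none] := pselect (exists j, P j); last first.
  rewrite [rowcnt _]big1 ?addn0 => [|j _]; first exact: clattice_count_letter ext_clattice.
  by case: eqP => // e; case: none; exists j; rewrite /P ltn_ord e eqxx.
case: (ex_minnP ex) => j0 /andP[jm /eqP e0] min0.
(* Left of column c0 + j0 the row has only letters <= k, by minimality of j0, so the letters of D
   there are smaller than k. *)
have cD (v : nat) : (k <= v)%N -> count_right D g (c0 + j0%:Z) v = count_letter D g v.
  move=> kv; rewrite /count_right /count_letter big_mkcond big_seq [RHS]big_seq; apply: eq_bigr => -[x y] bD /=.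
  case: ifP => // lt; case: eqP => // ev.
  have [_ /= cy] := Dbelow bD.
  have [i ei] : exists i : nat, y = c0 + i%:Z by exists (absz (y - c0)%R); lia.
  have ij : (i < j0)%N by lia.
  have im := ltn_trans ij jm.
  have lt2 : (g (x, y) < g (f i))%N by apply: ext_below => //=; rewrite ei.
  rewrite ev in lt2.
  have le2 := row_mono (ltnW ij) jm.
  have /min0 : P i by rewrite /P im /=; apply/eqP; lia.
  lia.
have := gl (c0 + j0%:Z) k; rewrite !(count_right_ext ext) !cD //.
rewrite [X in (_ <= _ + X)%N]big1 => [|j]; last first.
  rewrite fE /= => le; case: eqP => // e.
  by have := row_mono (i := j0) (j := j) _ (ltn_ord j); rewrite e0 fE e; lia.
rewrite addn0 (_ : (\sum_(j < m | _) _)%N = rowcnt k.+1) //.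
rewrite /rowcnt big_mkcond; apply: eq_bigr => j _; rewrite fE /=.
case: ifP => // lt; case: eqP => // e.
have /min0 : P j by rewrite /P ltn_ord fE e eqxx.
lia.
Qed.

(** Two equal letters k.+1 would force, by [row_horizontal_strip], a drop of two between the counts
    of k and k.+1. Two letters 0 are excluded because every box of the row but the first has a box
    of D above it. *)
Lemma row_strict (i j : nat) :
  (forall k, (count_letter D g k <= (count_letter D g k.+1).+1)%N) ->
  (forall j, (j.+1 < m)%N -> exists2 b : box, b \in D & b.2 = c0 + j.+1%:Z) ->
  (i < j)%N -> (j < m)%N -> (g (f i) < g (f j))%N.
Proof.
move=> hd hc ij jm.
have h1 i1 : (i1.+1 < m)%N -> (g (f i1) < g (f i1.+1))%N.
  move=> i1m; rewrite ltn_neqAle (row_mono (leqnSn i1) i1m) andbT; apply/eqP => e.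
  have i1m' : (i1 < m)%N by apply: ltnW.
  case ek: (g (f i1.+1)) => [|k].
    have [b bD bc] := hc _ i1m.
    by have := ext_below (b := b) bD i1m; rewrite bc ek => /(_ (lexx _)).
  have := row_horizontal_strip k; have := hd k.
  have : (2 <= rowcnt k.+1)%N.
    rewrite /rowcnt (bigD1 (Ordinal i1m)) //= (bigD1 (Ordinal i1m')) /=.
      by rewrite e ek eqxx.
    by rewrite -val_eqE /=; lia.
  lia.
elim: j ij jm => // j IH; rewrite ltnS leq_eqVlt => /orP[/eqP ->|lt] jm; first exact: h1.
by apply: ltn_trans (IH lt (ltnW jm)) (h1 _ jm).
Qed.

(** From letter N to N.+1 the count in S drops at least by the number of letters N in the row. These
    drops telescope, and over all letters they add up to the row length m. *)
Lemma row_total (n : nat) :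
  (forall b : box, b \in S -> (g b < n)%N) -> (m <= count_letter S g 0)%N.
Proof.
move=> hn.
have h N : (\sum_(k < N) rowcnt k + count_letter S g N <= count_letter S g 0)%N.
  elim: N => [|N IH]; first by rewrite big_ord0.
  rewrite big_ord_recr /=; apply: leq_trans IH.
  have eS k : count_letter S g k = (count_letter D g k + rowcnt k)%N := count_letter_ext ext g k.
  have := row_horizontal_strip N; rewrite !eS => hN.
  by rewrite -addnA leq_add2l; lia.
apply: leq_trans (h n); apply: leq_trans (leq_addr _ _).
rewrite /rowcnt exchange_big /= -[X in (X <= _)%N]card_ord -sum1_card.
apply: leq_sum => j _; have fj := hn _ (ext_row (ltn_ord j)).
by rewrite (bigD1 (Ordinal fj)) //= eqxx.
Qed.

End RowExtension.

(** A drop of two or more would skip the value v, while in a fat staircase every value from 1 to the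
    largest part occurs. *)
Lemma fat_staircase_drop (nu : intpart) (k : nat) : fat_staircase nu ->
  (nth 0%N nu k <= (nth 0%N nu k.+1).+1)%N.
Proof.
case/andP => hc _; rewrite leqNgt; apply/negP => lt.
set v := (nth 0%N nu k.+1).+1 in lt.
have v0 : (v <= nth 0%N nu 0)%N by have := intpart_nth_le nu (leq0n k); lia.
have : count_mem v nu != 0%N.
  apply: contraNneq hc => e; rewrite -e; apply: map_f.
  by rewrite mem_iota nth0 in v0 *; rewrite /v; lia.
rewrite -lt0n -has_count has_pred1 => /(nthP 0%N) [p _ e].
have [pk|kp] := leqP p k; first by have := intpart_nth_le nu pk; rewrite e leqNgt lt.
by have := intpart_nth_le nu kp; rewrite e ltnn.
Qed.

(** Ensures that the row of length m also fits below the rotated diagram of each nu occurring in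
    s_D. Here D is regarded as its upper rows D' extended by its own bottom row, so that [row_total]
    applies. *)
Lemma lr_col_bound (D : {fset box}) (nu : intpart) : convex D -> D != fset0 ->
  lr_col D nu != 0%N -> (last_row_length D <= nth 0%N nu 0)%N.
Proof.
move=> cD D0; rewrite -lt0n => /card_gt0P[T]; rewrite inE => /asboolP lrT.
have [blD hbl] := bottom_leftP D0.
case eb : (bottom_left D) blD hbl => [r c] /= blD hbl.
pose D' := [fset b in D | b.1 != r].
have ext : is_ext D D' (last_row_length D) (fun j => (r, c + j%:Z)).
  split=> [[x y]|j j' []|j]; last 2 first.
  - by move=> e; lia.
  - by rewrite !inE /= eqxx andbF.
  rewrite !inE /=; split=> [bD|[/andP[]//|[j jm ->]]]; last first.
    by have := last_rowP cD D0 jm; rewrite eb.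
  have [e|ne] := eqVneq x r; [right|by left; rewrite bD].
  rewrite e in bD *.
  case: (hbl _ bD) => /=; first by rewrite ltxx.
  case=> _ cy; exists (absz (y - c)%R); last by congr pair; lia.
  rewrite /last_row_length eb /=; set L := [fset b in D | _].
  have sub : {subset [seq (r, c + k%:Z) | k <- iota 0 (absz (y - c)%R).+1] <= enum_fset L}.
    move=> _ /mapP[k + ->]; rewrite mem_iota /= => ky; rewrite !inE /= eqxx andbT.
    by apply: (cD _ _ _ blD bD) => /=; lia.
  have := uniq_leq_size _ sub; rewrite size_map size_iota; apply.
  by rewrite map_inj_uniq ?iota_uniq // => k k' [] ?; lia.
have [hs hl <-] := lrT.
apply: (row_total (r := r) (c0 := c) ext _ _ hs hl (n := size nu)) => // [b|b bD].
  rewrite !inE /= => /andP[bD ne].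
  by have := hbl _ bD; have := bottom_left_col cD bD; rewrite eb /=; lia.
exact: is_lr_bound lrT bD.
Qed.
(** * Rotated straight shapes with a row below them *)

Section RotatedShape.
Variable nu : intpart.
Hypothesis nu0 : (0 < size nu)%N.

Let Dl := rot180 (ferrers nu).

Lemma mem_rot_ferrers (b : box) :
  reflect (exists i j, (j < nth 0 nu i)%N /\ b = (- i.+1%:Z, - j.+1%:Z)) (b \in Dl).
Proof.
rewrite mem_rot180; apply: (iffP (mem_ferrers _ _)) => -[i [j [h e]]]; exists i, j; split=> //.
  by case: b e => x y [/= <- <-]; rewrite !opprK.
by rewrite e /= !opprK.
Qed.

Lemma rot_ferrers_neq0 : Dl != fset0.
Proof.
apply/fset0Pn; exists (- 1%:Z, - 1%:Z); apply/mem_rot_ferrers; exists 0%N, 0%N.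
by rewrite intpart_nth_gt0.
Qed.

Lemma rot_bottom_left : bottom_left Dl = (- 1, - (nth 0%N nu 0)%:Z).
Proof.
have h0 : (0 < nth 0 nu 0)%N by rewrite intpart_nth_gt0.
apply: bottom_left_eq => [|_ /mem_rot_ferrers[i [j [h ->]]] /=].
  by apply/mem_rot_ferrers; exists 0%N, (nth 0%N nu 0).-1; rewrite !prednK.
by have := intpart_nth_le nu (leq0n i); case: i h => [|i] h le; [right|left]; lia.
Qed.

Lemma rot_last_row : (nth 0%N nu 0 <= last_row_length Dl)%N.
Proof.
rewrite /last_row_length rot_bottom_left /=; set L := [fset b in Dl | _].
have sub : {subset [seq (- 1%:Z, - j.+1%:Z) | j <- iota 0 (nth 0%N nu 0)] <= enum_fset L}.
  move=> _ /mapP[j + ->]; rewrite mem_iota /= => hj; rewrite !inE /= andbT.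
  by apply/mem_rot_ferrers; exists 0%N, j.
have := uniq_leq_size _ sub; rewrite size_map size_iota; apply.
by rewrite map_inj_uniq ?iota_uniq // => j j' [] ?; lia.
Qed.

(** Part number j, counted from 0, of the conjugate partition. *)
Definition col_height (j : nat) : nat := find (fun p => p <= j)%N nu.

Lemma col_heightP (j k : nat) : (k < col_height j)%N = (j < nth 0%N nu k)%N.
Proof.
apply/idP/idP => [lt|lt]; first by have := before_find 0%N lt => /negbT; rewrite -ltnNge.
rewrite ltnNge; apply/negP => le.
have ks : (k < size nu)%N by rewrite -intpart_nth_gt0; apply: leq_ltn_trans lt.
have /(nth_find 0%N) : has (fun p => p <= j)%N nu by rewrite has_find (leq_ltn_trans le).
by rewrite leqNgt (leq_trans lt) // intpart_nth_le.
Qed.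

(* Every column of the rotated diagram is filled with 0, 1, 2, ... downwards. *)
Definition rot_fill (b : box) : nat := (col_height (absz b.2).-1 - absz b.1)%N.

Lemma rot_fillE (i j : nat) :
  rot_fill (- i.+1%:Z, - j.+1%:Z) = (col_height j - i.+1)%N.
Proof. by []. Qed.

(** A column of height h contains each letter below h exactly once, so k occurs in the column at -
    j.+1 exactly when j < [nth 0 nu k]. *)
Lemma count_right_rot_fill (c : int) (k : nat) :
  count_right Dl rot_fill c k = (\sum_(j < nth 0 nu k | (c <= - j.+1%:Z)%R) 1)%N.
Proof.
have -> : count_right Dl rot_fill c k =
    (\sum_(b <- ferrers nu) if (c <= - b.2)%R then nat_of_bool (rot_fill (- b.1, - b.2)%R == k) else 0)%N.
  rewrite /count_right big_mkcond big_imfset //=.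
  by move=> [x y] [x' y'] _ _ /= [/oppr_inj -> /oppr_inj ->].
rewrite big_ferrers /=.
have e (i : 'I_(size nu)) : (\sum_(j < nth 0 nu i) (if (c <= - j.+1%:Z)%R
      then nat_of_bool (rot_fill (- i.+1%:Z, - j.+1%:Z)%R == k) else 0) =
    \sum_(j < nth 0 nu 0) ((c <= - j.+1%:Z)%R && (i < col_height j) &&
      (col_height j - i.+1 == k)))%N.
  rewrite (big_ord_widen _ (fun j : nat => if (c <= - j.+1%:Z)%R
      then nat_of_bool (rot_fill (- i.+1%:Z, - j.+1%:Z)%R == k) else 0)%N (intpart_nth_le nu (leq0n i))).
  rewrite big_mkcond; apply: eq_bigr => j _; rewrite -col_heightP rot_fillE.
  by case: (_ < _)%N; case: (_ <= _).
rewrite (eq_bigr _ (fun i _ => e i)) exchange_big /=.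
rewrite (big_ord_widen_cond _ (fun j : nat => (c <= - j.+1%:Z)%R) (fun=> 1%N) (intpart_nth_le nu (leq0n k))).
rewrite [RHS]big_mkcond /=; apply: eq_bigr => j _; rewrite -col_heightP.
case: (c <= _) => /=; last by rewrite big1.
have [lt|ge] := ltnP k (col_height j); last first.
  by rewrite big1 // => i _; case: ltnP => //= ?; case: eqP => //; lia.
have hs : (col_height j <= size nu)%N by apply: find_size.
have hi : (col_height j - k.+1 < size nu)%N by lia.
rewrite (bigD1 (Ordinal hi)) //= big1 ?addn0 => [|i ni].
  by rewrite (_ : (_ < _)%N) /=; [case: eqP => //; lia|lia].
case: ltnP => //= ?; case: eqP => // e1; case/eqP: ni; apply: val_inj => /=; lia.
Qed.

Lemma count_letter_rot_fill (k : nat) : count_letter Dl rot_fill k = nth 0%N nu k.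
Proof.
have h (b : box) : b \in Dl -> - (nth 0%N nu 0)%:Z <= b.2.
  by case/mem_rot_ferrers => i [j [hj ->]] /=; have := intpart_nth_le nu (leq0n i); lia.
rewrite -(count_right_count_letter _ _ h) count_right_rot_fill -[RHS]card_ord -sum1_card; apply: eq_bigl => j.
have jk := leq_trans (ltn_ord j) (intpart_nth_le nu (leq0n k)).
by rewrite (_ : (_ <= _) = true) //; apply/idP; rewrite lerN2 lez_nat.
Qed.

Lemma rot_fill_ssytg : ssytg Dl rot_fill.
Proof.
split=> _ _ /mem_rot_ferrers[i [j [h ->]]] /mem_rot_ferrers[i' [j' [h' ->]]] /= e lt;
  rewrite !rot_fillE.
  have -> : i = i' by lia.
  apply: leq_sub2r; rewrite leqNgt; apply/negP => lt2.
  have jj' : (j' < j)%N by lia.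
  move: lt2; rewrite col_heightP => /(ltn_trans jj').
  by rewrite -col_heightP ltnn.
have ej : j = j' by lia.
rewrite ej in h *; rewrite -col_heightP in h; lia.
Qed.

Variables (m : nat) (x : nat -> nat) (mu : intpart).
Hypothesis x_strict : forall i j, (i < j)%N -> (j < m)%N -> (x i < x j)%N.
Hypothesis x_strip : forall k,
  (nth 0 nu k.+1 + \sum_(j < m) (x j == k.+1) <= nth 0 nu k)%N.
Hypothesis mu_eq : forall k, (nth 0 mu k = nth 0 nu k + \sum_(j < m) (x j == k))%N.

Let S := place_below [:: m] Dl 1.

(** The rotated diagram occupies negative rows, its lowest being row -1; the added row is row 0 and
    begins one column to the left, at - [nth 0 nu 0] - 1. *)
Definition row_fill (b : box) : nat :=
  if b.1 == 0 then x (absz (b.2 + (nth 0%N nu 0)%:Z + 1)) else rot_fill b.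

(** Passing from x t to the larger letter x t.+1 lowers the corresponding part of nu by at least
    one, by [x_strip]. The bound yields both column strictness and the lattice condition for the
    extended filling. *)
Lemma strip_bound (t : nat) : (t < m)%N -> (nth 0 nu (x t) + t <= nth 0 nu 0)%N.
Proof.
elim: t => [_|t IH tm]; first by rewrite addn0 intpart_nth_le.
have lt := x_strict (ltnSn t) tm.
case e : (x t.+1) lt => [|k] // lt; have := x_strip k.
rewrite (bigD1 (Ordinal tm)) //= e eqxx => h.
have := IH (ltnW tm); have := intpart_nth_le nu (i := x t) (j := k); lia.
Qed.

Lemma rot_rowbox (t : nat) : rowbox Dl t = (0, - (nth 0%N nu 0)%:Z - 1 + t%:Z).
Proof. by rewrite /rowbox rot_bottom_left. Qed.

Lemma row_fill_row (t : nat) : row_fill (rowbox Dl t) = x t.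
Proof. by rewrite rot_rowbox /row_fill /=; congr x; lia. Qed.

Lemma row_fill_rot (b : box) : b \in Dl -> row_fill b = rot_fill b.
Proof. by rewrite /row_fill; case/mem_rot_ferrers => i [j [_ ->]]. Qed.

Lemma row_fill_lr : is_lr S mu row_fill.
Proof.
have cD : convex Dl by apply: convex_rot180; apply: convex_ferrers.
have ext := row_ext m cD rot_ferrers_neq0; have [hS _ _] := ext.
have count_letterE k : count_letter S row_fill k = nth 0%N mu k.
  rewrite (count_letter_ext ext) mu_eq -count_letter_rot_fill; congr addn.
    by rewrite /count_letter big_seq [RHS]big_seq; apply: eq_bigr => b /row_fill_rot ->.
  by apply: eq_bigr => j _; rewrite row_fill_row.
split=> //.
- have [h1 h2] := rot_fill_ssytg.
  split=> b b' /hS[bD|[t tm ->]] /hS[b'D|[t' tm' ->]].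
  + by rewrite !row_fill_rot //; apply: h1.
  + by rewrite rot_rowbox; case/mem_rot_ferrers: bD => i [j [_ ->]].
  + by rewrite rot_rowbox; case/mem_rot_ferrers: b'D => i [j [_ ->]].
  + rewrite !row_fill_row !rot_rowbox /= => _ lt; apply: ltnW; apply: x_strict => //; lia.
  + by rewrite !row_fill_rot //; apply: h2.
  + rewrite row_fill_row rot_rowbox row_fill_rot //.
    case/mem_rot_ferrers: bD => i [j [h ->]] /= e _; rewrite rot_fillE.
    (* The box with index t' lies under the column with j = [nth 0 nu 0] - t'; the bound says that
       the height of this column is at most x t', hence all its letters are smaller. *)
    have sb := strip_bound tm'; rewrite -col_heightP in h.
    have : (col_height j <= x t')%N by rewrite leqNgt col_heightP -leqNgt; lia.
    by lia.
  + by rewrite rot_rowbox; case/mem_rot_ferrers: b'D => i [j [_ ->]] /=; lia.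
  + by rewrite !rot_rowbox /= ltxx.
move=> c k; rewrite !(count_right_ext ext).
have eD v : count_right Dl row_fill c v = (\sum_(j < nth 0 nu v | (c <= - j.+1%:Z)%R) 1)%N.
  by rewrite -count_right_rot_fill; apply: eq_count_right => b bD _; apply: row_fill_rot.
rewrite !eD; have le := intpart_nth_le nu (leqnSn k).
have [[t [tm ct xt]]|none] := pselect (exists t, [/\ (t < m)%N,
    c <= (rowbox Dl t).2 & x t = k.+1]); last first.
  rewrite [X in (_ + X <= _)%N]big1 ?addn0 => [|j cj].
    apply: leq_trans (leq_addr _ _).
    rewrite (big_ord_widen_cond _ (fun j : nat => (c <= - j.+1%:Z)%R) (fun=> 1%N) le).
    by rewrite big_mkcond [leqRHS]big_mkcond; apply: leq_sum => j _; case: ifP => // /andP[->].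
  by rewrite row_fill_row; case: eqP => // e; case: none; exists j.
apply: leq_trans (leq_addr _ _).
have -> : (\sum_(j < m | (c <= (rowbox Dl j).2)%R) (row_fill (rowbox Dl j) == k.+1) = 1)%N.
  rewrite (bigD1 (Ordinal tm)) //= row_fill_row xt eqxx big1 // => j /andP[_ nj].
  rewrite row_fill_row; case: eqP => // e; case/eqP: nj; apply: val_inj => /=.
  case: (ltngtP j t) => // lt; first by have := x_strict lt tm; lia.
  by have := x_strict lt (ltn_ord j); lia.
(* The column at - ([nth 0 nu k.+1]) - 1 therefore contains k but not k.+1, and by [strip_bound] it
   is not left of the added k.+1. Its k compensates for that letter. *)
have lt : (nth 0 nu k.+1 < nth 0 nu k)%N.
  by have := x_strip k; rewrite (bigD1 (Ordinal tm)) //= xt eqxx; lia.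
rewrite (big_ord_widen_cond _ (fun j : nat => (c <= - j.+1%:Z)%R) (fun=> 1%N) le).
rewrite [X in (_ <= X)%N](bigD1 (Ordinal lt)) /=; last first.
  by have := strip_bound tm; move: ct; rewrite rot_rowbox xt /=; lia.
rewrite addnC leq_add2l big_mkcond [leqRHS]big_mkcond; apply: leq_sum => j _.
case: ifP => // /andP[-> jlt] /=; case: eqP => // e.
by rewrite e /= ltnn in jlt.
Qed.

End RotatedShape.
(** * Comparison of the coefficients *)

Section RowBelow.
Variables (D : {fset box}) (m : nat).
Hypotheses (cD : convex D) (D0 : D != fset0) (mD : (m - 1 <= last_row_length D)%N).
Hypothesis drop : forall nu : intpart, nu \in intparts_of #|` D| ->
  lr_col D nu != 0%N -> forall k, (nth 0%N nu k <= (nth 0%N nu k.+1).+1)%N.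

Let S := place_below [:: m] D 1.
Let S' := place_below (nseq m 1%N) D 1.
Let ext : is_ext S D m (rowbox D) := row_ext m cD D0.

Let rowbox_below (b : box) : b \in D ->
  b.1 < (bottom_left D).1 + 1 /\ (bottom_left D).2 - 1 <= b.2.
Proof.
move=> bD; have [_ hbl] := bottom_leftP D0; have := bottom_left_col cD bD.
by case: (hbl _ bD) => [?|[? ?]]; split; lia.
Qed.

Variables (n : nat) (mu : intpart).

Definition restr (T : {ffun S -> 'I_n}) : {ffun D -> 'I_n} :=
  [ffun u => T [` ext_sub ext (valP u)]].

Lemma entry_restr (T : {ffun S -> 'I_n}) (b : box) : b \in D -> entry (restr T) b = entry T b.
Proof. by move=> bD; rewrite -[b]/(val [` bD]) entryE ffunE -entryE. Qed.

(** The restriction is itself a witness that its content has a nonzero coefficient in s_D, so [drop]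
    applies to this content. *)
Lemma lr_restr (T : {ffun S -> 'I_n}) : T \in lr_set S n mu ->
  [/\ ssyt (restr T), clattice D (entry (restr T)), lr_col D (content (restr T)) != 0%N,
      forall i j, (i < j)%N -> (j < m)%N -> (entry T (rowbox D i) < entry T (rowbox D j))%N
    & forall k, (nth 0 (content (restr T)) k.+1 +
        \sum_(j < m) (entry T (rowbox D j) == k.+1) <= nth 0 (content (restr T)) k)%N].
Proof.
rewrite inE => /asboolP[hs hl _].
have rE j : rowbox D j = ((bottom_left D).1 + 1, (bottom_left D).2 - 1 + j%:Z) by [].
have hs' : ssyt (restr T).
  apply/ssytgP; have [h1 h2] := ext_ssytg ext hs.
  by split=> b b' bD b'D; rewrite !entry_restr //; [apply: h1|apply: h2].
have hl0 := ext_clattice ext rE rowbox_below hs hl.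
have cE k : count_letter D (entry (restr T)) k = count_letter D (entry T) k.
  by rewrite /count_letter big_seq [RHS]big_seq; apply: eq_bigr => b bD; rewrite entry_restr.
have hl' : clattice D (entry (restr T)).
  by move=> c k; rewrite !(eq_count_right (g' := entry T)) // => b bD _; apply: entry_restr.
have nuD : content (restr T) \in intparts_of #|` D|.
  by rewrite mem_intparts_of sumn_content.
have nz : lr_col D (content (restr T)) != 0%N.
  rewrite -(card_lr_content D0 nuD (size_content hl')) -lt0n; apply/card_gt0P.
  by exists (restr T); rewrite inE hs' eqxx andbT /=; apply/asboolP.
have nuE k : nth 0%N (content (restr T)) k = count_letter D (entry T) k by rewrite content_nth.
split=> //; last by move=> k; rewrite !nuE; apply: row_horizontal_strip ext rE rowbox_below hs hl k.
move=> i j; apply: (row_strict ext rE rowbox_below hs hl).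
  by move=> k; rewrite -!nuE; apply: drop.
move=> j1 j1m; have /(last_rowP cD D0) lD : (j1 < last_row_length D)%N by lia.
by exists ((bottom_left D).1, (bottom_left D).2 + j1%:Z) => //=; lia.
Qed.

(* The letters of the added row are strictly increasing, so they may as well be
   put into a column. *)
Lemma lr_row_le_col : (0 < size mu)%N -> n = size mu ->
  (lr_col S mu <= lr_col S' mu)%N.
Proof.
move=> mu0 en; have ext' : is_ext S' D m (colbox D) := col_ext m cD D0.
have [hS _ _] := ext; have [hS' _ _] := ext'.
pose h (b : box) : box := if b.2 == (bottom_left D).2 - 1
  then rowbox D (absz (b.1 - (bottom_left D).1 - 1)%R) else b.
have hcol j : h (colbox D j) = rowbox D j.
  by rewrite /h /= eqxx; congr rowbox; lia.
have hD (b : box) : b \in D -> h b = b.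
  move=> bD; rewrite /h; case: eqP => // e.
  by have := bottom_left_col cD bD; rewrite e; lia.
rewrite /lr_col -en; apply: (lr_card_le (h := h)); rewrite ?en //.
  move=> b /hS[bD|[j jm ->]]; first by exists b; [apply/hS'; left|exact: hD].
  by exists (colbox D j); [apply/hS'; right; exists j|exact: hcol].
rewrite -en => T TL; have [_ _ _ strict _] := lr_restr TL.
move: TL; rewrite inE => /asboolP[hs hl hc].
have count_letterE k : count_letter S' (entry T \o h) k = nth 0%N mu k.
  rewrite -hc (count_letter_ext ext) (count_letter_ext ext') /=; congr addn.
    by rewrite /count_letter big_seq [RHS]big_seq; apply: eq_bigr => b /hD /= ->.
  by apply: eq_bigr => j _; rewrite hcol.
have rE j : rowbox D j = ((bottom_left D).1 + 1, (bottom_left D).2 - 1 + j%:Z) by [].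
split=> //.
  have [h1 h2] := ext_ssytg ext hs.
  split=> b b' /hS'[bD|[j jm ->]] /hS'[b'D|[j' jm' ->]] e lt; rewrite /= ?hcol.
  - by rewrite !hD //; apply: h1.
  - by have := colbox_sep j' cD bD; lia.
  - by have := colbox_sep j cD b'D; lia.
  - by move: lt; rewrite /= ltxx.
  - by rewrite !hD //; apply: h2.
  - by have := colbox_sep j' cD bD; lia.
  - by have := colbox_sep j cD b'D; lia.
  - by apply: strict => //; move: lt => /=; lia.
(* From the column of the bottom-left box on, only D is counted; any smaller c counts all boxes, and
   the totals are the parts of mu. *)
move=> c k; have [le|lt] := lerP (bottom_left D).2 c.
  have cE v : count_right S' (entry T \o h) c v = count_right D (entry T) c v.
    rewrite (count_right_ext ext') big1 ?addn0 => [|j /= ?]; last lia.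
    by apply: eq_count_right => b bD _ /=; rewrite hD.
  by rewrite !cE; apply: (ext_clattice ext rE rowbox_below hs hl).
have cE v : count_right S' (entry T \o h) c v = count_letter S' (entry T \o h) v.
  apply: count_right_count_letter => b /hS'[bD|[j _ ->]] /=; last lia.
  by have := bottom_left_col cD bD; lia.
by rewrite !cE !count_letterE; exact: intpart_nth_le.
Qed.

Lemma restr_inj : {in lr_set S n mu &, injective restr}.
Proof.
move=> T T' TL T'L e.
have [_ hl _ st _] := lr_restr TL; have [_ _ _ st' _] := lr_restr T'L.
have eD (b : box) : b \in D -> entry T b = entry T' b.
  by move=> bD; rewrite -entry_restr // e entry_restr.
move: TL T'L; rewrite !inE => /asboolP[_ _ hc] /asboolP[_ _ hc'].
pose w (T : {ffun S -> 'I_n}) := [seq entry T (rowbox D j) | j <- iota 0 m].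
have sw (T1 : {ffun S -> 'I_n}) : (forall i j, (i < j)%N -> (j < m)%N ->
    (entry T1 (rowbox D i) < entry T1 (rowbox D j))%N) -> sorted ltn (w T1).
  move=> h; apply/(sortedP 0%N) => i; rewrite size_map size_iota => im.
  by rewrite !(nth_map 0%N) ?size_iota ?(ltnW im) // !nth_iota ?(ltnW im) //; apply: h.
have mw (T1 : {ffun S -> 'I_n}) k :
    (k \in w T1) = (0 < \sum_(j < m) (entry T1 (rowbox D j) == k))%N.
  apply/mapP/idP => [[j + ->]|].
    by rewrite mem_iota /= => jm; rewrite (bigD1 (Ordinal jm)) //= eqxx.
  rewrite lt0n sum_nat_eq0 negb_forall => /existsP[j]; rewrite /= eqb0 negbK => /eqP <-.
  by exists j; rewrite // mem_iota /=.
have ew : w T = w T'.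
  apply: (irr_sorted_eq ltn_trans ltnn (sw _ st) (sw _ st')) => k; rewrite !mw.
  congr (0 < _)%N; have := hc k; rewrite -(hc' k) !(count_letter_ext ext).
  suff -> : count_letter D (entry T) k = count_letter D (entry T') k by move/addnI.
  by rewrite /count_letter big_seq [RHS]big_seq; apply: eq_bigr => b /eD ->.
have er j : (j < m)%N -> entry T (rowbox D j) = entry T' (rowbox D j).
  move=> jm; have : nth 0%N (w T) j = nth 0%N (w T') j by rewrite ew.
  by rewrite !(nth_map 0%N) ?size_iota // nth_iota.
apply/ffunP => s; apply: val_inj; rewrite /= -!entryE.
by have [hS _ _] := ext; have /hS[/eD|[j jm ->]] := valP s; rewrite ?er.
Qed.

(** Restriction being injective, it suffices that F (content U) >= 1 for each restriction U of some
    T. The last row of T, placed below the rotated diagram of that content, gives a filling that is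
    counted by F. *)
Lemma lr_row_le_rot : n = size mu ->
  (lr_col S mu <= \sum_(nu <- intparts_of #|` D|)
     lr_col (place_below [:: m] (rot180 (ferrers nu)) 1) mu * lr_col D nu)%N.
Proof.
move=> en; pose F (nu : intpart) := lr_col (place_below [:: m] (rot180 (ferrers nu)) 1) mu.
pose P (U : {ffun D -> 'I_n}) := ssyt U && `[< clattice D (entry U) >].
have le1 : (lr_col S mu <= \sum_(U | P U) F (content U))%N.
  rewrite /lr_col -en -(card_in_imset restr_inj) -sum1_card big_mkcond [leqRHS]big_mkcond.
  apply: leq_sum => U _; case: ifP => // /imsetP[T TL ->].
  have [hs hl nz st strip] := lr_restr TL.
  rewrite /P hs (asboolT hl) /=; apply/card_gt0P.
  set nu := content (restr T) in nz strip *.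
  have nuD : nu \in intparts_of #|` D| by rewrite mem_intparts_of sumn_content.
  have muE k : (nth 0 mu k = nth 0 nu k + \sum_(j < m) (entry T (rowbox D j) == k))%N.
    move: TL; rewrite inE => /asboolP[_ _ <-]; rewrite (count_letter_ext ext) content_nth //.
    congr addn; rewrite /count_letter big_seq [RHS]big_seq.
    by apply: eq_bigr => b bD; rewrite entry_restr.
  have lrF := row_fill_lr (intpart_pos_size D0 nuD) st strip muE.
  set Sn := place_below _ _ _ in lrF *.
  have bnd (u : Sn) := is_lr_bound lrF (valP u).
  exists [ffun u => Ordinal (bnd u)]; rewrite inE; apply/asboolP.
  by apply: eq_is_lr lrF => b bS; rewrite -[b]/(val [` bS]) entryE ffunE.
apply: leq_trans le1 _.
rewrite (sum_by_content F) => [|U /andP[_ /asboolP]//].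
rewrite [leqLHS]big_seq [leqRHS]big_seq; apply: leq_sum => nu nuD.
have -> (x y : nat) : x *+ y = (x * y)%N.
  by elim: y => [|y IH]; [rewrite muln0|rewrite mulrS IH mulnS].
have [sn|ns] := leqP (size nu) n.
  by rewrite /P card_lr_content // mulnC.
rewrite [X in (_ * X <= _)%N](_ : _ = 0%N) ?muln0 //; apply: eq_card0 => U.
rewrite inE; apply/negP => /andP[/andP[_ /asboolP hl] /eqP e].
by have := size_content hl; rewrite e leqNgt ns.
Qed.

End RowBelow.

(** * From coefficients to Schur positivity *)

Lemma schur_ge_intro (d : nat) (a : intpart -> int) (f g : symfct) :
  (forall nu, nu \in intparts_of d -> 0 <= a nu) ->
  (forall n, f n - g n = \sum_(nu <- intparts_of d) a nu *: schur (ferrers nu) n) ->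
  schur_ge f g.
Proof.
move=> a0 h; pose A := [fset nu in intparts_of d].
exists [fsfun nu in A => a nu | 0] => [nu|n].
  by rewrite fsfunE; case: ifP => //; rewrite !inE => /a0.
rewrite h; have sA : finsupp [fsfun nu in A => a nu | 0] `<=` A.
  by apply/fsubsetP => nu; rewrite mem_finsupp fsfunE; case: ifP; rewrite ?eqxx.
rewrite (big_fset_incl _ sA) /=; last first.
  by move=> nu _; rewrite memNfinsupp => /eqP ->; rewrite scale0r.
have pA : perm_eq A (intparts_of d).
  by apply: uniq_perm; rewrite ?fset_uniq ?intparts_of_uniq // => nu; rewrite !inE.
rewrite (perm_big _ pA); apply: eq_big_seq => nu nuA.
by rewrite fsfunE !inE nuA.
Qed.

(** Follows from [schur_rot180] and linear independence. It supplies the drop condition when the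
    rotated diagram takes the place of D. *)
Lemma lr_col_rot (nu nu' : intpart) : (0 < size nu)%N -> nu' \in intparts_of (sumn nu) ->
  lr_col (rot180 (ferrers nu)) nu' = (nu' == nu).
Proof.
move=> nu0 nuP; have cF := @convex_ferrers nu; have cR := convex_rot180 cF.
pose z (k : intpart) : int := (lr_col (rot180 (ferrers nu)) k)%:Z - (k == nu)%:Z.
suff /(_ nu' nuP) : forall k, k \in intparts_of (sumn nu) -> z k = 0.
  by rewrite /z => /eqP; rewrite subr_eq0 => /eqP [].
apply: schur_free; under eq_bigr do rewrite scalerBl.
rewrite sumrB; apply/eqP; rewrite subr_eq0; apply/eqP.
transitivity (schur (ferrers nu) (sumn nu)).
  rewrite -(schur_rot180 _ cF) (schur_lr_col _ cR (rot_ferrers_neq0 nu0)).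
  by rewrite card_rot180 card_ferrers; apply: eq_bigr => k _; rewrite -natz scaler_nat.
rewrite (bigD1_seq nu) ?intparts_of_uniq ?mem_intparts_of //= eqxx scale1r.
by rewrite big1 ?addr0 // => k /negPf ->; rewrite scale0r.
Qed.

Lemma Delta_mults (nu : intpart) : fat_staircase nu -> Delta (mults nu) = rot180 (ferrers nu).
Proof. by case/andP => _ /eqP e; rewrite /Delta -e. Qed.

Lemma sum_fat (V : nmodType) (d : nat) (F : intpart -> V) :
  \sum_(nu <- fat_staircases_of d) F nu =
  \sum_(nu <- intparts_of d) (if fat_staircase nu then F nu else 0).
Proof. by rewrite big_filter big_mkcond. Qed.

Theorem theorem5p4 (rho kappa : intpart) (lam1 : nat) :
  let D := skew_diagram rho kappa in
  let lam := [:: lam1] in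
  let lamt := nseq lam1 1%N in
  let mid : symfct := fun n =>
    \sum_(nu <- fat_staircases_of #|` D|)
      (schur (place_below lamt (Delta (mults nu)) 1) n
       - schur (place_below lam (Delta (mults nu)) 1) n) *+ lrcoef kappa nu rho in
  (ferrers kappa `<=` ferrers rho) ->
  D != fset0 ->
  sum_of_fat_staircases rho kappa ->
  (0 < lam1)%N ->
  (lam1 - 1 <= last_row_length D)%N ->
  schur_ge (fun n => schur (place_below lamt D 1) n
                     - schur (place_below lam D 1) n) mid
  /\ schur_ge mid (fun=> 0).
Proof.
move: lam1 => m D lam lamt mid _ D0 hfat m0 mD; rewrite /lam /lamt.
pose d := #|` D|; pose c (nu : intpart) := lrcoef kappa nu rho.
have cD : convex D by apply: convex_skew.
have hsum n : schur D n = \sum_(nu <- fat_staircases_of d) schur (ferrers nu) n *+ c nu.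
  exact: hfat.
(* Two Schur expansions of s_D are compared, the one by [lr_col] and the one of the hypothesis. This
   is where the column reading meets [lrcoef], and where all coefficients at other partitions are
   seen to vanish. *)
have lrD (nu : intpart) : nu \in intparts_of d ->
    lr_col D nu = if fat_staircase nu then c nu else 0%N.
  move=> nuD; apply/eqP; rewrite -eqz_nat -subr_eq0; apply/eqP.
  pose z (k : intpart) : int := (lr_col D k)%:Z - (if fat_staircase k then c k else 0%N)%:Z.
  move: nu nuD; apply: (schur_free (z := z)); rewrite /z.
  under eq_bigr do rewrite scalerBl.
  rewrite sumrB; apply/eqP; rewrite subr_eq0; apply/eqP.
  transitivity (schur D d).
    rewrite schur_lr_col //; apply: eq_bigr => k _; by rewrite -natz scaler_nat.
  rewrite hsum sum_fat; apply: eq_bigr => k _; rewrite -natz scaler_nat.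
  by case: ifP.
have drop (nu : intpart) : nu \in intparts_of d -> lr_col D nu != 0%N ->
    forall k, (nth 0%N nu k <= (nth 0%N nu k.+1).+1)%N.
  move=> nuD; rewrite lrD //; case: ifP => // f _ k; exact: fat_staircase_drop.
pose Sr (nu : intpart) := place_below [:: m] (rot180 (ferrers nu)) 1.
pose Sc (nu : intpart) := place_below (nseq m 1%N) (rot180 (ferrers nu)) 1.
have dm : (0 < d + m)%N by rewrite addn_gt0 m0 orbT.
(* For c nu = 0 the row may be too long for the rotated diagram of nu; such terms are split off
   before any expansion is used. *)
have fats (nu : intpart) : nu \in fat_staircases_of d -> c nu != 0%N ->
    [/\ fat_staircase nu, (0 < size nu)%N, sumn nu = d & (m - 1 <= nth 0%N nu 0)%N].
  rewrite mem_filter => /andP[f nuD] cnz; split=> //.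
  - exact: intpart_pos_size nuD.
  - by move: nuD; rewrite mem_intparts_of => /eqP.
  - by apply: leq_trans mD _; apply: lr_col_bound => //; rewrite lrD // f.
have cR (nu : intpart) : convex (rot180 (ferrers nu)).
  by apply: convex_rot180; apply: convex_ferrers.
have cardR (nu : intpart) : #|` rot180 (ferrers nu)| = sumn nu.
  by rewrite card_rot180 card_ferrers.
have neq0_ext S A f : is_ext S A m f -> S != fset0.
  by move=> e; rewrite -cardfs_gt0 (card_ext e) addn_gt0 m0 orbT.
have expand S A f n : convex S -> is_ext S A m f -> #|` A| = d ->
    schur S n = \sum_(mu <- intparts_of (d + m)) (lr_col S mu)%:Z *: schur (ferrers mu) n.
  move=> cS e eA; rewrite (schur_lr_col _ cS (neq0_ext _ _ _ e)) (card_ext e) eA.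
  by apply: eq_bigr => k _; rewrite -natz scaler_nat.
have expSr (nu : intpart) n : nu \in fat_staircases_of d -> c nu != 0%N -> schur (Sr nu) n =
    \sum_(mu <- intparts_of (d + m)) (lr_col (Sr nu) mu)%:Z *: schur (ferrers mu) n.
  move=> nuD nz; have [f s0 sn mn] := fats _ nuD nz; have R0 := rot_ferrers_neq0 s0.
  apply: (expand _ _ _ n _ (row_ext m (cR nu) R0)); last by rewrite cardR.
  by apply: convex_place_row => //; apply: leq_trans mn (rot_last_row s0).
have expSc (nu : intpart) n : nu \in fat_staircases_of d -> c nu != 0%N -> schur (Sc nu) n =
    \sum_(mu <- intparts_of (d + m)) (lr_col (Sc nu) mu)%:Z *: schur (ferrers mu) n.
  move=> nuD nz; have [f s0 sn mn] := fats _ nuD nz; have R0 := rot_ferrers_neq0 s0.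
  apply: (expand _ _ _ n _ (col_ext m (cR nu) R0)); last by rewrite cardR.
  exact: convex_place_col.
have midE n : mid n = \sum_(nu <- fat_staircases_of d) (schur (Sc nu) n - schur (Sr nu) n) *+ c nu.
  rewrite /mid /lam /lamt; apply: eq_big_seq => nu; rewrite mem_filter => /andP[f _].
  by rewrite Delta_mults.
have musize (mu : intpart) : mu \in intparts_of (d + m) -> (0 < size mu)%N.
  by rewrite mem_intparts_of => /eqP e; rewrite -e in dm; case: (parts mu) dm.
split.
(* The column terms on both sides agree by [colE], so only the row terms remain, with reversed
   signs. *)
- pose a (mu : intpart) : int :=
    (\sum_(nu <- fat_staircases_of d) lr_col (Sr nu) mu * c nu)%N%:Z -
    (lr_col (place_below [:: m] D 1) mu)%:Z.
  apply: (@schur_ge_intro (d + m) a) => [mu muP|n].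
    rewrite /a subr_ge0 lez_nat.
    apply: leq_trans (lr_row_le_rot cD D0 mD drop (n := size mu) erefl) _.
    rewrite sum_fat [leqLHS]big_seq [leqRHS]big_seq; apply: leq_sum => nu nuD; rewrite lrD //.
    by case: ifP => // _; rewrite muln0.
  have colE : schur (place_below (nseq m 1%N) D 1) n =
      \sum_(nu <- fat_staircases_of d) schur (Sc nu) n *+ c nu.
    rewrite schur_place_col // hsum mulr_suml; apply: eq_big_seq => nu nuD.
    have [->|nz] := eqVneq (c nu) 0%N; first by rewrite !mulr0n mul0r.
    have [f s0 sn mn] := fats _ nuD nz.
    rewrite /Sc schur_place_col // ?rot_ferrers_neq0 // schur_rot180 ?mulrnAl //.
    exact: convex_ferrers.
  rewrite midE; under [X in _ - X]eq_bigr do rewrite mulrnBl.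
  rewrite sumrB colE opprB addrC addrA subrK.
  have -> : schur (place_below [:: m] D 1) n = \sum_(mu <- intparts_of (d + m))
      (lr_col (place_below [:: m] D 1) mu)%:Z *: schur (ferrers mu) n.
    by apply: (expand _ _ _ n _ (row_ext m cD D0)) => //; apply: convex_place_row.
  rewrite /a; under [RHS]eq_bigr do rewrite scalerBl.
  rewrite [RHS]sumrB; congr (_ - _).
  transitivity (\sum_(nu <- fat_staircases_of d) \sum_(mu <- intparts_of (d + m))
      (lr_col (Sr nu) mu * c nu)%N%:Z *: schur (ferrers mu) n).
    apply: eq_big_seq => nu nuD; have [->|nz] := eqVneq (c nu) 0%N.
      by rewrite mulr0n big1 // => mu _; rewrite muln0 scale0r.
    rewrite expSr // -sumrMnl; apply: eq_bigr => mu _.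
    by rewrite -!natz !scaler_nat mulrnA.
  rewrite exchange_big /=; apply: eq_bigr => mu _.
  rewrite -scaler_suml; congr (_ *: _); rewrite -natz natr_sum.
  by apply: eq_bigr => nu _; rewrite natz.
pose a (mu : intpart) : int :=
  \sum_(nu <- fat_staircases_of d) ((lr_col (Sc nu) mu)%:Z - (lr_col (Sr nu) mu)%:Z) *+ c nu.
apply: (@schur_ge_intro (d + m) a) => [mu muP|n].
  rewrite /a big_seq; apply: sumr_ge0 => nu nuD.
  have [->|nz] := eqVneq (c nu) 0%N; first by rewrite mulr0n.
  have [f s0 sn mn] := fats _ nuD nz.
  apply: mulrn_wge0; rewrite subr_ge0 lez_nat.
  (* The row-to-column comparison is applied with the rotated diagram as D; its only content is the
     fat staircase nu, which has small drops. *)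
  apply: (lr_row_le_col (cR nu) (rot_ferrers_neq0 s0) _ _ (musize _ muP) erefl).
    exact: leq_trans mn (rot_last_row s0).
  move=> nu' nuP'; rewrite cardR in nuP'; rewrite lr_col_rot //.
  by have [->|] := eqVneq nu' nu => [_ k|_]; [apply: fat_staircase_drop|rewrite eqxx].
rewrite subr0 midE /a.
transitivity (\sum_(nu <- fat_staircases_of d) \sum_(mu <- intparts_of (d + m))
    (((lr_col (Sc nu) mu)%:Z - (lr_col (Sr nu) mu)%:Z) *+ c nu) *: schur (ferrers mu) n).
  apply: eq_big_seq => nu nuD; have [->|nz] := eqVneq (c nu) 0%N.
    by rewrite mulr0n big1 // => mu _; rewrite mulr0n scale0r.
  rewrite expSr // expSc // -sumrB -sumrMnl; apply: eq_bigr => mu _.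
  by rewrite -scalerBl scalerMnl.
by rewrite exchange_big /=; apply: eq_bigr => mu _; rewrite scaler_suml.
Qed.
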